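(* Let $\mathcal{C}$ be a finite abstract simplicial complex, let $\mathcal{V}=\{V_1,\ldots,V_n\}$ be a partition of its vertex set $V(\mathcal{C})$, and let $\eta \in \{\eta_\pi,\eta_H\}$. If $\eta(\mathcal{C}[V_I]) \ge |I|+1$ for all nonempty $I \subseteq [n]$, where $V_I = \bigcup_{i\in I} V_i$, then the reconfiguration graph $\mathbf{RG}(\mathcal{C},\mathcal{V})$ is connected.
   Context: For a subset $X$ of the ground set, $\mathcal{C}[X]=\{\sigma\in\mathcal{C}:\sigma\subseteq X\}$. A complex is homotopically $k$-connected if for every $-1\le j\le k$ every continuous map $S^j\to\|\mathcal{C}\|$ extends to $B^{j+1}$ (being $(-1)$-connected means having nonempty geometric realization, i.e. at least one vertex). $\eta_\pi(\mathcal{C})$ is $2$ plus the largest $k\ge -2$ such that $\mathcal{C}$ is homotopically $j$-connected for all $j\le k$ (so $\eta_\pi=0$ if $\mathcal{C}$ has no vertices, and $\eta_\pi=\infty$ if it is $k$-connected for all $k$). $\eta_H(\mathcal{C})$ is $2$ plus the largest $k\ge-2$ such that the reduced simplicial homology $\widetilde H_j(\mathcal{C};\mathbb{Q})$ vanishes for all $-1\le j\le k$ (where $\widetilde H_{-1}=0$ means $\mathcal{C}$ has at least one vertex), possibly $\infty$. A colorful simplex of $(\mathcal{C},\mathcal{V})$ is a simplex of $\mathcal{C}$ containing exactly one vertex from each $V_i$. $\mathbf{RG}(\mathcal{C},\mathcal{V})$ has the colorful simplices as vertices, two being adjacent if their union is a simplex of $\mathcal{C}$ of size $n+1$. *)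

(* Defs.v *)
From HB Require Import structures.
From mathcomp Require Import all_boot all_order all_algebra.
From mathcomp Require Import all_classical all_reals all_analysis.
From mathcomp Require Import Rstruct Rstruct_topology.
Set Implicit Arguments. Unset Strict Implicit. Unset Printing Implicit Defensive.
Import Order.TTheory GRing.Theory Num.Theory.
Local Open Scope ring_scope.
Notation Real := Rdefinitions.R.

Section SimplicialComplexes.
Variable T : finType.

Definition is_complex (C : {set {set T}}) : Prop :=
  forall s t : {set T}, s \in C -> t \subset s -> t \in C.

Definition vertices (C : {set {set T}}) : {set T} := [set v | [set v] \in C].

Definition induced (C : {set {set T}}) (X : {set T}) : {set {set T}} :=
  [set s in C | s \subset X].

Local Open Scope classical_set_scope.
Definition coordv (x : 'rV[Real]_#|T|) (v : T) : Real := x ord0 (enum_rank v).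

Definition realization (C : {set {set T}}) : set 'rV[Real]_#|T| :=
  [set x | (forall v, 0 <= coordv x v) /\ (\sum_(v : T) coordv x v = 1)
           /\ finset (fun v => coordv x v != 0) \in C].

End SimplicialComplexes.
Local Open Scope classical_set_scope.

Definition unit_sphere (k : nat) : set 'rV[Real]_k :=
  [set x | \sum_(i < k) x ord0 i ^+ 2 = 1].
Definition unit_ball (k : nat) : set 'rV[Real]_k :=
  [set x | \sum_(i < k) x ord0 i ^+ 2 <= 1].

Arguments unit_sphere k _ : clear implicits.
Arguments unit_ball k _ : clear implicits.

(* homot_conn C k  <->  C is homotopically (k-1)-connected:
   every continuous map S^(k-1) -> ||C|| extends to B^k.
   (k = 0: S^(-1) is empty, B^0 a point: ||C|| nonempty.) *)
Definition homot_conn (T : finType) (C : {set {set T}}) (k : nat) : Prop :=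
  forall f : 'rV[Real]_k -> 'rV[Real]_#|T|,
    {within (unit_sphere k), continuous f} ->
    f @` unit_sphere k `<=` realization C ->
    exists g : 'rV[Real]_k -> 'rV[Real]_#|T|,
      [/\ {within (unit_ball k), continuous g},
          g @` unit_ball k `<=` realization C &
          forall x, unit_sphere k x -> g x = f x].

Local Close Scope classical_set_scope.

Section Homology.
Variable T : finType.

(* Oriented basis of C_(k-1): simplices of size k; for k = 0 this is
   always the single empty simplex (augmentation, C_(-1) = Q). *)
Definition simplices (C : {set {set T}}) (k : nat) : {set {set T}} :=
  [set s : {set T} | ((s \in C) || (k == 0)%N) && (#|s| == k)].

Definition vpos (s : {set T}) (v : T) : nat :=
  #|[set u in s | (enum_rank u < enum_rank v)%N]|.

(* Boundary map from size-k simplices to size-(k-1) simplices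
   (row-vector convention: chain c is mapped to c *m bnd C k);
   [v_0..v_(k-1)] |-> sum_i (-1)^i [.. omit v_i ..]; bnd C 0 = 0. *)
Definition bnd (C : {set {set T}}) (k : nat) :
    'M[rat]_(#|simplices C k|, #|simplices C k.-1|) :=
  \matrix_(i, j)
    (let s := @enum_val _ (mem (simplices C k)) i in
     let t := @enum_val _ (mem (simplices C k.-1)) j in
     if (0 < k)%N && (t \subset s)
     then (-1) ^+ (\sum_(v in s :\: t) vpos s v) else 0).

(* reduced homology H~_(k-1)(C; Q) vanishes: ker d_k  \subseteq  im d_(k+1) *)
Definition hom_vanish (C : {set {set T}}) (k : nat) : bool :=
  (kermx (bnd C k) <= bnd C k.+1)%MS.

End Homology.

Inductive eta_kind := EtaPi | EtaH.

(* eta_ge e C m  <->  eta(C) >= m, i.e. the (k-1)-th connectivity condition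
   holds for every -1 <= k-1 <= m-2, i.e. for every k < m. *)
Definition eta_ge (e : eta_kind) (T : finType) (C : {set {set T}}) (m : nat)
  : Prop :=
  forall k : nat, (k < m)%N ->
    match e with
    | EtaPi => homot_conn C k
    | EtaH => hom_vanish C k
    end.

Section Reconfiguration.
Variables (T : finType) (n : nat).

Definition is_vertex_partition (C : {set {set T}}) (V : 'I_n -> {set T})
  : Prop :=
  [/\ forall i, V i != finset.set0,
      forall i j, i != j -> [disjoint V i & V j] &
      \bigcup_(i < n) V i = vertices C].

Definition colorful (C : {set {set T}}) (V : 'I_n -> {set T}) (s : {set T})
  : bool := (s \in C) && [forall i, #|s :&: V i| == 1%N].

Definition rg_adj (C : {set {set T}}) (V : 'I_n -> {set T}) : rel {set T} :=
  fun s t => [&& colorful C V s, colorful C V t,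
                 (s :|: t) \in C & #|s :|: t| == n.+1].

Definition rg_connected (C : {set {set T}}) (V : 'I_n -> {set T}) : Prop :=
  forall s t, colorful C V s -> colorful C V t -> connect (rg_adj C V) s t.

End Reconfiguration.

(* Main.v *)
From mathcomp Require Import boolp classical_sets filter reals Rstruct Rstruct_topology.
From mathcomp Require Import topology normedtype realfun.
Require Import Defs.
From mathcomp Require Import all_boot all_order all_algebra all_fingroup.
From mathcomp Require Import zify ring lra.

(* Let s and t be colorful simplices, and for I in [n] write s_I, t_I for their
   faces with colors in I.

   Homology: vanishing of the reduced homology of C[V_I] in dimension |I| - 1
   yields, by induction on |I|, chains h(I) in C[V_I] of dimension |I| with
   boundary h(I) = t_I - s_I - sum_i +-h(I \ i).  Let chi be the cochain taking
   the value 1 on the colorful simplices in the component of s in the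
   reconfiguration graph (oriented by their colors) and 0 elsewhere.  An
   n-dimensional simplex has either no or two colorful facets, adjacent and
   induced with opposite orientations, so chi vanishes on boundaries; it also
   vanishes on the h([n] \ i).  Hence chi(t) = chi(s) = 1.

   Homotopy: the same cells h(I) are built as continuous maps, i.e. the prism
   (simplex on [n]) x [0, 1] is mapped to ||C|| with s on the bottom, t on the
   top and each (face I) x [0, 1] going to ||C[V_I]||.  A fine enough Kuhn
   triangulation of a cube covering the prism is labeled by vertices of C; mod 2,
   Sperner's lemma gives an odd number of rainbow facets on the bottom, from
   which paths through rainbow facets lead to the top, and the label sets of
   consecutive facets are equal or adjacent in the reconfiguration graph. *)

Set Implicit Arguments. Unset Strict Implicit. Unset Printing Implicit Defensive.
Import Order.TTheory GRing.Theory Num.Theory numFieldNormedType.Exports.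

(** * Kuhn's triangulation of the cube and Sperner's lemma *)

Section Kuhn.
Variable N : nat.

(* Grid points are functions [nat -> nat], zero from the n-th coordinate on, so
   that the facet x_n = 0 of the (n+1)-cube is literally the n-cube. *)
Definition kuhn_cell n (v : {ffun 'I_n -> 'I_N.+1}) (s : 'S_n) (k : 'I_n.+1)
    (i : nat) : nat :=
  if insub i is Some j then v j + (s j < k) else 0.

Definition face (X : Type) m (p : 'I_m.+1 -> X) (k : 'I_m.+1) : 'I_m -> X :=
  fun i => p (lift k i).

(** The number mod 2 of m-cells of the triangulation of the cube [0, N+1]^m that satisfy [g]: a cell
    is given by its lowest vertex [v] and by the order [s] in which the coordinates are raised. *)
Definition kuhn_sum m (g : ('I_m.+1 -> nat -> nat) -> bool) : bool :=
  \big[addb/false]_(s : 'S_m) \big[addb/false]_(v : {ffun 'I_m -> 'I_N.+1}) g (kuhn_cell v s).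

Lemma kuhn_cellE n (v : {ffun 'I_n -> 'I_N.+1}) s k (i : 'I_n) :
  kuhn_cell v s k i = v i + (s i < k).
Proof. by rewrite /kuhn_cell valK. Qed.

Lemma kuhn_cell_out n (v : {ffun 'I_n -> 'I_N.+1}) s k i :
  n <= i -> kuhn_cell v s k i = 0.
Proof. by move=> le_ni; rewrite /kuhn_cell insubF // ltnNge le_ni. Qed.

Lemma kuhn_cell_close n (v : {ffun 'I_n -> 'I_N.+1}) s k i :
  kuhn_cell v s ord0 i <= kuhn_cell v s k i <= (kuhn_cell v s ord0 i).+1.
Proof.
rewrite /kuhn_cell; case: insub => [j|//]; rewrite ltn0 addn0 leq_addr /=.
by case: (s j < k); rewrite ?addn0 ?addn1.
Qed.

(** Exchanging the steps k-1 and k of a cell moves its k-th vertex only. The cells with lowest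
    vertex [v] are thus paired so that both members of a pair share the facet dropping k, and their
    contributions cancel mod 2. *)
Lemma face_interior0 m (g : ('I_m.+1 -> nat -> nat) -> bool)
    (v : {ffun 'I_m.+1 -> 'I_N.+1}) (k : 'I_m.+2) :
  0 < k < m.+1 -> \big[addb/false]_(s : 'S_m.+1) g (face (kuhn_cell v s) k) = false.
Proof.
case/andP=> k_gt0 lt_km.
have ltk1 : k.-1 < m.+1 by rewrite (leq_ltn_trans (leq_pred k)).
pose a := Ordinal ltk1; pose b := Ordinal lt_km.
have neq_ab : a != b by rewrite -val_eqE /= neq_ltn prednK ?leqnn.
pose P (s : 'S_m.+1) := ((s^-1)%g a < (s^-1)%g b).
rewrite (bigID P) /= [X in X (+) _](reindex_inj (mulIg (tperm a b))) /=.
rewrite [X in X (+) _](_ : _ = \big[addb/false]_(s | ~~ P s)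
    g (face (kuhn_cell v s) k)) ?addbb //; apply: eq_big => [s|s _].
  rewrite /P invMg tpermV !permM tpermL tpermR -leqNgt [RHS]leq_eqVlt.
  by rewrite val_eqE (inj_eq perm_inj) eq_sym (negbTE neq_ab).
congr g; apply/funext => l; apply/funext => i.
rewrite /face /kuhn_cell; case: insub => // j; congr (_ + nat_of_bool _).
have neq_lk : lift k l != k :> nat by rewrite eq_sym neq_lift.
rewrite permM; move: (nat_of_ord (lift k l)) neq_lk => L; rewrite eq_sym => neq_kL.
by case: tpermP => // ->; rewrite /= [k < L]ltn_neqAle neq_kL prednK.
Qed.

Lemma ord_predS n (w : 'I_n.+1) : w != ord0 -> (ord_pred w).+1 = w.
Proof.
case: w => [[|k] ltk] // _; by rewrite /= modnDr modn_small // ltnW.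
Qed.

(* The facets dropping the first vertex of a cell are glued to those dropping
   the last vertex of the next cell in the direction of the first step. *)
Lemma face_first_last m (v : {ffun 'I_m.+1 -> 'I_N.+1}) (s : 'S_m.+1) :
  let j := (s^-1)%g ord_max in
  v j != ord0 ->
  face (kuhn_cell [ffun i => if i == j then ord_pred (v i) else v i]
          (s * perm (can_inj (@ordSK m.+1)))%g) ord0
    = face (kuhn_cell v s) ord_max.
Proof.
move=> j vj0; apply/funext => l; apply/funext => i.
rewrite /face /kuhn_cell; case: insub => // a.
rewrite !ffunE permM permE lift0 lift_max /=.
have [->|neq_aj] := eqVneq a j.
  by rewrite /j permKV modnn /= addn1 ord_predS // [_ < l]ltnNge -ltnS ltn_ord addn0.
rewrite modn_small //; last first.
  rewrite ltnS ltn_neqAle -ltnS ltn_ord andbT.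
  apply: contra neq_aj => /eqP eq_sm; rewrite -(permK s a); apply/eqP.
  by congr (_ _); apply: val_inj.
Qed.

(** Stokes' formula mod 2: inner facets are counted twice, and the hypotheses discard every facet on
    the boundary of the cube except those on x_m = 0, which make up the triangulation of the
    m-cube. *)
Lemma kuhn_stokes m (g : ('I_m.+1 -> nat -> nat) -> bool) :
  (forall p j, j < m.+1 -> (forall k, p k j = N.+1) -> g p = false) ->
  (forall p j, j < m -> (forall k, p k j = 0) -> g p = false) ->
  kuhn_sum (fun p : 'I_m.+2 -> nat -> nat =>
              \big[addb/false]_(k < m.+2) g (face p k)) =
  kuhn_sum g.
Proof.
move=> g_top g_bot; rewrite /kuhn_sum.
pose B (v : {ffun 'I_m.+1 -> 'I_N.+1}) s := g (face (kuhn_cell v s) ord_max).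
pose j (s : 'S_m.+1) := (s^-1)%g ord_max.
have first : \big[addb/false]_(s : 'S_m.+1) \big[addb/false]_v
      g (face (kuhn_cell v s) ord0)
    = \big[addb/false]_(s : 'S_m.+1) \big[addb/false]_(v : {ffun 'I_m.+1 -> 'I_N.+1} | v (j s) != ord0) B v s.
  rewrite (reindex_inj (mulIg (perm (can_inj (@ordSK m.+1))))) /=.
  apply: eq_bigr => s _; pose h (v : {ffun 'I_m.+1 -> 'I_N.+1}) :=
    [ffun i => if i == j s then ord_pred (v i) else v i].
  have h_inj : injective h.
    move=> v w /ffunP eq_h; apply/ffunP => i; move: (eq_h i); rewrite !ffunE.
    by case: eqP => // _ /(can_inj (@ord_predK _)).
  rewrite (reindex_inj h_inj) /= [RHS]big_mkcond /=.
  apply: eq_bigr => v _; case: (boolP (v (j s) != ord0)) => [vj|].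
    by rewrite /B -face_first_last.
  (* [ord_pred] wraps 0 around to N, so this facet lies on x_j = N+1, where [g] vanishes. *)
  rewrite negbK => /eqP vj; apply: (g_top _ (j s)) => // k.
  rewrite /face kuhn_cellE ffunE eqxx permM permE lift0 /= /j permKV vj /=.
  by rewrite modnn addn1 /= modn_small.
transitivity (\big[addb/false]_(s : 'S_m.+1)
    \big[addb/false]_(v : {ffun 'I_m.+1 -> 'I_N.+1} | v (j s) == ord0) B v s).
  transitivity ((\big[addb/false]_(s : 'S_m.+1) \big[addb/false]_v
      g (face (kuhn_cell v s) ord0)) (+)
      (\big[addb/false]_(s : 'S_m.+1) \big[addb/false]_v B v s)).
    rewrite exchange_big /= [X in X (+) _]exchange_big [X in _ (+) X]exchange_big.
    rewrite -big_split; apply: eq_bigr => v _ /=.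
    rewrite exchange_big /= (bigD1 ord0) //= (bigD1 ord_max) //=.
    rewrite [X in _ (+) (_ (+) X)]big1 ?addbF // => k /andP[k0 kmax].
    apply: face_interior0; rewrite lt0n k0 /=.
    by rewrite ltn_neqAle kmax -ltnS ltn_ord.
  rewrite first -big_split; apply: eq_bigr => s _ /=.
  rewrite [X in _ (+) X](bigID (fun v : {ffun _} => v (j s) == ord0)) /=.
  by rewrite addbCA addbb addbF.
(* The facets left lie on x_j = 0, where j is the coordinate raised last. For j < m they are
   discarded by [g_bot]; for j = m they correspond to the cells of the m-cube through [lift_perm]
   and [up]. *)
rewrite (bigID (fun s : 'S_m.+1 => s ord_max == ord_max)) /= addbC big1 => [|s sm].
  2: { apply: big1 => v /eqP vj; apply: (g_bot _ (j s)) => [|k].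
    rewrite ltn_neqAle -ltnS ltn_ord andbT; apply: contra sm => /eqP eq_j.
    by rewrite -{1}(_ : j s = ord_max) ?permKV //; apply: val_inj.
  by rewrite /face kuhn_cellE vj /j permKV lift_max ltnNge -ltnS ltn_ord. }
rewrite addFb.
have lift_perm_inj : injective (@lift_perm m ord_max ord_max).
  move=> s t eq_st; apply/permP => k; apply: (@lift_inj _ ord_max).
  by rewrite -!(lift_perm_lift ord_max) eq_st.
have lift_perm_surj (s : 'S_m.+1) : s ord_max == ord_max ->
    exists s' : 'S_m, lift_perm ord_max ord_max s' = s.
  move=> /eqP sm; pose f k := odflt k (unlift ord_max (s (lift ord_max k))).
  have fE k : lift ord_max (f k) = s (lift ord_max k).
    rewrite /f; case: unliftP => //= /esym; rewrite -{1}sm => /perm_inj eq_max.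
    by have := neq_lift ord_max k; rewrite -eq_max eqxx.
  have f_inj : injective f.
    by move=> k l eq_f; apply: (@lift_inj _ ord_max); apply: (@perm_inj _ s); rewrite -!fE eq_f.
  exists (perm f_inj); apply/permP => k; case: (unliftP ord_max k) => [k'|] ->.
    by rewrite lift_perm_lift permE fE.
  by rewrite lift_perm_id sm.
rewrite (reindex (lift_perm ord_max ord_max)) /=; last first.
  exists (fun s => odflt 1%g [pick s' | lift_perm ord_max ord_max s' == s]).
    move=> s _; case: pickP => [s' /eqP/lift_perm_inj //|/(_ s)].
    by rewrite eqxx.
  move=> s /lift_perm_surj[s' <-]; case: pickP => [? /eqP //|/(_ s')].
  by rewrite eqxx.
apply: eq_big => [s|s _]; first by rewrite lift_perm_id eqxx.
have -> : j (lift_perm ord_max ord_max s) = ord_max.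
  by rewrite /j lift_permV lift_perm_id.
pose up (v : {ffun 'I_m -> 'I_N.+1}) : {ffun 'I_m.+1 -> 'I_N.+1} :=
  [ffun i => if unlift ord_max i is Some i' then v i' else ord0].
rewrite (reindex up) /=; last first.
  exists (fun v => [ffun i => v (lift ord_max i)]) => [v _|v /eqP vmax].
    by apply/ffunP => i; rewrite !ffunE liftK.
  by apply/ffunP => i; rewrite !ffunE; case: unliftP => [i'|] ->; rewrite ?ffunE.
apply: eq_big => [v|v _]; first by rewrite ffunE unlift_none eqxx.
congr g; apply/funext => k; apply/funext => i; rewrite /face.
have [lt_im|] := ltnP i m; last rewrite leq_eqVlt => /orP[/eqP<-|lt_mi].
- rewrite -[i]/(nat_of_ord (Ordinal lt_im)) -(lift_max (Ordinal lt_im)).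
  by rewrite kuhn_cellE ffunE liftK lift_perm_lift !lift_max kuhn_cellE.
- rewrite -[m]/(nat_of_ord (@ord_max m)) kuhn_cellE ffunE unlift_none.
  by rewrite lift_perm_id lift_max ltnNge -ltnS ltn_ord kuhn_cell_out.
- by rewrite !kuhn_cell_out // ltnW.
Qed.

End Kuhn.

(** If dropping k0 leaves each color below n exactly once, then either k0 has another color, and
    every other facet misses a color, or k0 repeats the color of a unique k1, and dropping k1 is the
    only alternative. *)
Lemma rainbow_faces n (c : 'I_n.+1 -> nat) (R : 'I_n.+1 -> bool) :
  (forall k, reflect (forall i, i < n -> exists l, face c k l = i) (R k)) ->
  [\/ forall k, R k = false,
      exists k0, [/\ R k0, n <= c k0 & forall k, R k = (k == k0)]
    | exists k0 k1, [/\ k0 != k1, c k0 = c k1, c k0 < n &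
                       forall k, R k = (k \in [:: k0; k1])]].
Proof.
move=> RP; have [/existsP[k0 Rk0]|] := boolP [exists k, R k]; last first.
  by move=> /existsPn noR; constructor 1 => k; apply/negbTE.
have faceP k i : (exists l, face c k l = i) <-> (exists2 x, x != k & c x = i).
  split=> [[l <-]|[x neq_xk <-]]; first by exists (lift k l); rewrite // eq_sym neq_lift.
  by case: (unliftP k x) neq_xk => [l ->|->]; [exists l | rewrite eqxx].
have /RP cov := Rk0.
have /fin_all_exists[e eK] (i : 'I_n) : exists l, face c k0 l = i.
  exact: cov.
have e_inj : injective e by move=> i j eq_e; apply: val_inj; rewrite /= -!eK eq_e.
have faceE l : face c k0 l = invF e_inj l by rewrite -{1}(f_invF e_inj l) eK.
have c_lt x : x != k0 -> c x < n.
  case: (unliftP k0 x) => [l ->|->]; last by rewrite eqxx.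
  by rewrite -[c _]/(face c k0 l) faceE.
have c_inj x y : x != k0 -> y != k0 -> c x = c y -> x = y.
  case: (unliftP k0 x) => [l ->|->]; last by rewrite eqxx.
  case: (unliftP k0 y) => [l' ->|->]; last by rewrite eqxx.
  rewrite -![c _]/(face c k0 _) !faceE => _ _ /val_inj eq_inv.
  by rewrite -[l](f_invF e_inj) eq_inv f_invF.
have [le_nc|lt_cn] := leqP n (c k0).
  constructor 2; exists k0; split => // k; apply/idP/eqP => [/RP cov'|-> //].
  apply/eqP; apply: contraT => neq_k; have /faceP[x neq_xk eq_c] := cov' _ (c_lt _ neq_k).
  have [eq_x|neq_x] := eqVneq x k0.
    by move: (c_lt _ neq_k); rewrite -eq_c eq_x ltnNge le_nc.
  by rewrite (c_inj x k) ?eqxx // in neq_xk.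
have /faceP[k1 neq_k1 eq_c] := cov _ lt_cn.
have Rk1 : R k1.
  apply/RP => i lt_in; have /faceP[x neq_x <-] := cov _ lt_in.
  apply/faceP; have [->|neq_x1] := eqVneq x k1; last by exists x.
  by exists k0; rewrite // eq_sym.
constructor 3; exists k0, k1; split; rewrite 1?eq_sym // => k.
rewrite !inE; have [->|neq_k] := eqVneq k k0; first by rewrite Rk0.
have [->//|neq_kk1] := eqVneq k k1; apply/negP => /RP cov'.
have /faceP[x neq_xk eq_cx] := cov' _ (c_lt _ neq_k).
have [eq_x|neq_x] := eqVneq x k0; last by rewrite (c_inj x k) ?eqxx // in neq_xk.
by rewrite (c_inj k k1) ?eqxx // -?eq_cx ?eq_x // in neq_kk1.
Qed.

(** * Sperner's lemma for Kuhn's triangulation *)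

Section Sperner.
Variables (N : nat) (col : (nat -> nat) -> nat) (M : nat).
(** Sperner's condition pulled back along the collapse of the cube onto the simplex with vertices 0,
    ..., M: the face x_j = 0 goes to the face spanned by 0, ..., j, and x_j = N+1 to the face
    opposite to j. *)
Hypothesis col_le : forall x, col x <= M.
Hypothesis col_bot : forall x j, j < M -> x j = 0 -> col x <= j.
Hypothesis col_top : forall x j, j < M -> x j = N.+1 -> col x != j.

Definition rainbow m (p : 'I_m -> nat -> nat) : bool :=
  [forall i : 'I_m, exists k, col (p k) == i].

Lemma rainbowP m (p : 'I_m -> nat -> nat) :
  reflect (forall i, i < m -> exists k, col (p k) = i) (rainbow p).
Proof.
apply: (iffP forallP) => [all_i i lt_im|all_i i].
  by have /existsP[k /eqP] := all_i (Ordinal lt_im); exists k.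
by have [k colk] := all_i _ (ltn_ord i); apply/existsP; exists k; rewrite colk.
Qed.

Lemma rainbow_top m (p : 'I_m -> nat -> nat) j :
  j < m -> j < M -> (forall k, p k j = N.+1) -> rainbow p = false.
Proof.
move=> lt_jm lt_jM p_j; apply/negP => /rainbowP/(_ _ lt_jm)[k].
by apply/eqP; apply: col_top.
Qed.

Lemma rainbow_bot m (p : 'I_m.+1 -> nat -> nat) j :
  j < m -> j < M -> (forall k, p k j = 0) -> rainbow p = false.
Proof.
move=> lt_jm lt_jM p_j; apply/negP => /rainbowP/(_ m (leqnn _))[k colk].
by have := col_bot lt_jM (p_j k); rewrite colk leqNgt lt_jm.
Qed.

(** Induction on m through [kuhn_stokes]. On the (m+1)-cube the later coordinates vanish, so
    [col_bot] and [col_le] bound the colors by m+1; then by [rainbow_faces] a cell has an odd number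
    of facets with all colors 0, ..., m exactly if it is rainbow itself. *)
Lemma sperner m : m <= M -> kuhn_sum N (@rainbow m.+1) = true.
Proof.
elim: m => [_|m IHm lt_mM].
  rewrite /kuhn_sum (big_pred1 1%g) => [|s]; last first.
    by symmetry; apply/eqP/permP => i; have := ltn_ord i.
  rewrite (big_pred1 [ffun _ => ord0]) => [|v]; last first.
    by symmetry; apply/eqP/ffunP => i; have := ltn_ord i.
  apply/rainbowP => i; rewrite ltnS leqn0 => /eqP ->; exists ord0.
  apply/eqP; rewrite -leqn0; case: (posnP M) => [M0|M_gt0].
    by rewrite -M0 col_le.
  by apply: (col_bot M_gt0); rewrite kuhn_cell_out.
rewrite -[RHS](IHm (ltnW lt_mM)) -[RHS]kuhn_stokes; first last.
- move=> p j lt_jm; apply: rainbow_bot (lt_jm) _.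
  exact: ltn_trans lt_jm lt_mM.
- move=> p j lt_jm; apply: rainbow_top (lt_jm) _; exact: leq_trans lt_jm lt_mM.
apply: eq_bigr => s _; apply: eq_bigr => v _; set p := kuhn_cell v s.
have col_p k : col (p k) <= m.+1.
  have [lt_m1M|le_Mm] := ltnP m.+1 M.
    by apply: (col_bot lt_m1M); rewrite /p kuhn_cell_out.
  by apply: leq_trans le_Mm; apply: col_le.
have RP k : reflect (forall i, i < m.+1 -> exists l, face (col \o p) k l = i)
                    (rainbow (face p k)).
  exact: rainbowP.
have lastR k : rainbow p -> col (p k) = m.+1 -> rainbow (face p k).
  move=> /rainbowP cov colk; apply/RP => i lt_im.
  have [l coll] := cov i (ltnW lt_im).
  case: (unliftP k l) coll => [l' ->|->] coll; first by exists l'.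
  by move: lt_im; rewrite -coll colk ltnn.
have lastP : rainbow p -> exists k, col (p k) = m.+1.
  by move/rainbowP/(_ m.+1 (leqnn _)).
have [noR|[k0 [Rk0 ge_k0 R_k0]]|[k0 [k1 [neq_k eq_c lt_c R_k]]]] := rainbow_faces RP.
- rewrite big1 //; apply/negP => rain; have [k colk] := lastP rain.
  by have := lastR _ rain colk; rewrite noR.
- rewrite (bigD1 k0) //= Rk0 big1 => [|k neq_k]; last by rewrite R_k0 (negbTE neq_k).
  apply/rainbowP => i; rewrite ltnS leq_eqVlt => /orP[/eqP->|lt_im].
    by exists k0; apply/eqP; rewrite eqn_leq col_p.
  by have /RP/(_ _ lt_im)[l coll] := Rk0; exists (lift k0 l).
- rewrite (bigD1 k0) //= (bigD1 k1) 1?eq_sym //= !R_k !inE !eqxx orbT /=.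
  rewrite big1 => [|k /andP[nk0 nk1]]; last by rewrite R_k !inE (negbTE nk0) (negbTE nk1).
  apply/negP => rain; have [k colk] := lastP rain.
  have := lastR _ rain colk; rewrite R_k !inE => /orP[]/eqP eq_k.
    by move: lt_c; rewrite /= -eq_k colk ltnn.
  by move: lt_c; rewrite eq_c /= -eq_k colk ltnn.
Qed.

End Sperner.

(** * Paths through rainbow facets *)

Section Paths.
Variables (T : finType) (N m : nat) (L : (nat -> nat) -> T) (col : T -> nat).
Variable e : rel {set T}.

(* The set of labels of a rainbow tuple is constant, up to e-paths, along the
   chain of rainbow facets of the triangulation; mod 2, these chains cannot
   end. *)
Lemma rainbow_path (s t : {set T}) :
  (forall x, col (L x) <= m) ->
  (forall x j, j < m -> x j = 0 -> col (L x) <= j) ->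
  (forall x j, j < m -> x j = N.+1 -> col (L x) != j) ->
  (forall x, x m = 0 -> L x \in s) ->
  (forall x, x m = N.+1 -> L x \in t) ->
  {in s &, injective col} -> {in t &, injective col} ->
  #|s| = m.+1 -> #|t| = m.+1 ->
  (forall v (p : 'S_m.+1) k l, let P i := L (kuhn_cell (N := N) v p i) in
     k != l -> col (P k) = col (P l) -> rainbow (col \o L) (face (kuhn_cell v p) k) ->
     connect e [set face P k i | i : 'I_m.+1] [set face P l i | i : 'I_m.+1]) ->
  connect_sym e -> connect e s t.
Proof.
move=> col_le col_bot col_top bot top s_inj t_inj s_card t_card adj e_sym.
have rain_all (u : {set T}) (p : 'I_m.+1 -> nat -> nat) :
    {in u &, injective col} -> #|u| = m.+1 -> (forall i, L (p i) \in u) ->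
    rainbow (col \o L) p -> [set L (p i) | i : 'I_m.+1] = u.
  move=> u_inj u_card p_u /rainbowP cov; apply/eqP; rewrite eqEcard.
  apply/andP; split; first by apply/subsetP => _ /imsetP[i _ ->].
  have /fin_all_exists[f fK] (i : 'I_m.+1) : exists k, col (L (p k)) = i.
    exact: cov.
  have f_inj : injective (fun i => L (p (f i))).
    by move=> i j eq_L; apply: val_inj; rewrite /= -!fK eq_L.
  rewrite u_card -{1}(card_ord m.+1) -cardsT -(card_imset _ f_inj).
  by apply/subset_leq_card/subsetP => _ /imsetP[i _ ->]; apply: imset_f.
apply/negPn/negP => not_st.
(* [f] marks the rainbow facets whose labels are reachable from [s]. There are none on the top,
   since [t] is assumed unreachable, so [kuhn_stokes] applies: each cell has zero or two marked
   facets, whereas on the bottom all rainbow facets are marked and Sperner's lemma makes their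
   number odd. *)
pose f (p : 'I_m.+1 -> nat -> nat) :=
  rainbow (col \o L) p && connect e s [set L (p i) | i : 'I_m.+1].
have f_top p j : j < m.+1 -> (forall k, p k j = N.+1) -> f p = false.
  rewrite ltnS leq_eqVlt /f => /orP[/eqP->|lt_jm] p_j; last first.
    by rewrite (_ : rainbow _ _ = false) //; apply: (rainbow_top col_top _ lt_jm p_j); exact: ltnW.
  apply/negP => /andP[/(rain_all t)-> //]; first exact/negP.
  by move=> i; apply: top.
have f_bot p j : j < m -> (forall k, p k j = 0) -> f p = false.
  by move=> lt_jm p_j; rewrite /f (_ : rainbow _ _ = false) //; apply: (rainbow_bot col_bot lt_jm _ p_j).
suff: kuhn_sum N f = false.
  suff -> : kuhn_sum N f = kuhn_sum N (@rainbow (col \o L) m.+1).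
    by rewrite (sperner col_le).
  apply: eq_bigr => p _; apply: eq_bigr => v _; rewrite /f.
  case: (boolP (rainbow _ _)) => //= /(rain_all s)-> //; first exact: connect0.
  by move=> i; apply: bot; rewrite kuhn_cell_out.
rewrite -(kuhn_stokes f_top f_bot) /kuhn_sum big1 // => p _; rewrite big1 // => v _.
pose P i := L (kuhn_cell v p i).
have RP k : reflect (forall i, i < m.+1 -> exists l, face (col \o P) k l = i)
                    (rainbow (col \o L) (face (kuhn_cell v p) k)).
  exact: rainbowP.
have [noR|[k0 [_ ge_k0 _]]|[k0 [k1 [neq_k eq_c _ R_k]]]] := rainbow_faces RP.
- by rewrite big1 // => k _; rewrite /f noR.
- by have := col_le (kuhn_cell v p k0); rewrite leqNgt ge_k0.
- rewrite (bigD1 k0) //= (bigD1 k1) 1?eq_sym //= big1 => [|k /andP[nk0 nk1]].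
    rewrite /f !R_k !inE !eqxx orbT /= addbF.
    have /(adj _ _ _ _ neq_k eq_c) : rainbow (col \o L) (face (kuhn_cell v p) k0).
      by rewrite R_k !inE eqxx.
    by move=> /(same_connect_r e_sym)/(_ s); rewrite addbC /face /= => ->; rewrite addbb.
  by rewrite /f R_k !inE (negbTE nk0) (negbTE nk1).
Qed.
End Paths.

Local Open Scope ring_scope.

(** * Homological connectivity *)

Section Chains.
Variable T : finType.
Local Notation chain := {ffun {set T} -> rat^o}.
Implicit Types (A C : {set {set T}}) (s t : {set T}) (c d : chain).

(** The incidence sign of v in v |: t. The order of the vertices is a parameter because [bnd]
    orients simplices by [enum_rank], while the argument on colorful simplices orients them by
    color. *)
Definition before (I : finType) (ord : I -> nat) (v : I) (t : {set I}) : rat :=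
  \prod_(u in t) (-1) ^+ (ord u < ord v)%N.

Definition boundary (ord : T -> nat) c : chain :=
  [ffun t : {set T} => \sum_(v | v \notin t) before ord v t * c (v |: t)].

Definition supported c A := forall s, s \notin A -> c s = 0.

Lemma boundaryB ord c d : boundary ord (c - d) = boundary ord c - boundary ord d.
Proof.
apply/ffunP => t; rewrite !ffunE -sumrB; apply: eq_bigr => v _.
by rewrite !ffunE mulrBr.
Qed.

Lemma boundary_sum ord (J : finType) (P : pred J) (a : J -> rat)
    (c : J -> chain) :
  boundary ord (\sum_(j | P j) a j *: c j) = \sum_(j | P j) a j *: boundary ord (c j).
Proof.
apply/ffunP => t; rewrite !ffunE sum_ffunE.
under eq_bigr => v _ do rewrite sum_ffunE mulr_sumr.
rewrite exchange_big /=; apply: eq_bigr => j _; rewrite !ffunE [RHS]mulr_sumr.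
by apply: eq_bigr => v _; rewrite !ffunE [LHS]mulrCA.
Qed.

Lemma sum_add_vertex t (F : {set T} -> rat) :
  \sum_(v | v \notin t) F (v |: t) = \sum_(s : {set T} | (t \subset s) && (#|s| == #|t|.+1)) F s.
Proof.
rewrite -big_set /= -(big_imset (h := fun v => v |: t) F) /=; last first.
  move=> v w; rewrite !inE => vt wt /setP/(_ v).
  by rewrite !inE eqxx (negbTE vt) !orbF => /esym/eqP. 
apply: eq_bigl => s; apply/imsetP/andP => [[v]|[ts /eqP card_s]].
  by rewrite inE => vt ->; rewrite subsetUr cardsU1 vt add1n.
have /cards1P[v sDt] : #|s :\: t| == 1%N.
  by rewrite cardsD (setIidPr ts) card_s subSnn.
have : v \in s :\: t by rewrite sDt set11.
rewrite inE => /andP[vt _]; exists v; rewrite ?inE //.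
by rewrite -sDt setDE setUIl [~: t :|: t]setUC setUCr setIT (setUidPl ts).
Qed.

Definition chain_row A c : 'rV[rat]_#|A| := \row_i c (enum_val i).

Definition row_chain A (x : 'rV[rat]_#|A|) : chain :=
  [ffun s : {set T} => \sum_(i | enum_val i == s) x 0 i].

Lemma row_chain_supported A (x : 'rV_#|A|) : supported (row_chain x) A.
Proof.
move=> s sA; rewrite ffunE big_pred0 // => i; apply/eqP => eq_s.
by rewrite -eq_s enum_valP in sA.
Qed.

Lemma row_chainK A : cancel (@row_chain A) (@chain_row A).
Proof.
move=> x; apply/rowP => i; rewrite !mxE ffunE (big_pred1 i) // => j.
by rewrite (inj_eq enum_val_inj).
Qed.

Lemma chain_row_boundary C k c : (0 < k)%N -> supported c (simplices C k) ->
  chain_row (simplices C k.-1) (boundary (fun v => enum_rank v) c)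
    = chain_row (simplices C k) c *m bnd C k.
Proof.
move=> k_gt0 supp_c; apply/rowP => j; rewrite !mxE ffunE.
set t := enum_val j.
have card_t : #|t| = k.-1.
  by have := enum_valP j; rewrite inE => /andP[_ /eqP].
pose F s := c s * (if t \subset s then (-1) ^+ (\sum_(v in s :\: t) vpos s v) else 0).
transitivity (\sum_(v | v \notin t) F (v |: t)).
  apply: eq_bigr => v vt; rewrite /F subsetUr mulrC; congr (_ * _).
  rewrite setDUl setDv setU0 (_ : [set v] :\: t = [set v]); last first.
    by apply/setDidPl; rewrite disjoints1.
  rewrite big_set1 /vpos /before prodrXr; congr (_ ^+ _).
  rewrite -[RHS]sum1_card big_mkcond [RHS]big_mkcond /=; apply: eq_bigr => u _.
  rewrite !inE; case: (boolP (u \in t)) => ut; rewrite ?orbT ?orbF /=.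
    by case: ltnP.
  by case: eqP => //= ->; rewrite ltnn.
rewrite sum_add_vertex.
transitivity (\sum_(s in simplices C k) F s); last first.
  rewrite big_enum_val; apply: eq_bigr => i _.
  by rewrite !mxE k_gt0.
rewrite big_mkcond [RHS]big_mkcond; apply: eq_bigr => s _.
have [/supp_c|] := boolP (s \notin simplices C k).
  by rewrite /F => ->; rewrite mul0r !if_same.
rewrite negbK => sC; rewrite sC; move: sC; rewrite inE => /andP[_ /eqP card_s].
by rewrite card_s card_t prednK // eqxx andbT /F; case: (t \subset s); rewrite ?mulr0.
Qed.

Lemma boundary_supported ord C k c : is_complex C ->
  supported c (simplices C k.+1) -> supported (boundary ord c) (simplices C k).
Proof.
move=> cC supp_c t; apply: contraNeq; rewrite ffunE => sum_neq0.
have /existsP[v /andP[vt]] : [exists v, (v \notin t) && (c (v |: t) != 0)].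
  apply: contraR sum_neq0 => /existsPn c0; rewrite big1 // => v vt.
  by have := c0 v; rewrite vt /= negbK => /eqP->; rewrite mulr0.
move=> /(contra_neqN (@supp_c _))/negPn.
rewrite !inE orbF cardsU1 vt add1n eqSS => /andP[/cC/(_ (subsetUr _ _))-> ->].
by [].
Qed.

Lemma hom_vanish_rank C k c : is_complex C -> hom_vanish C k -> (0 < k)%N ->
  supported c (simplices C k) -> boundary (fun v => enum_rank v) c = 0 ->
  exists2 d, supported d (simplices C k.+1) & boundary (fun v => enum_rank v) d = c.
Proof.
move=> cC van k_gt0 supp_c bd0.
have : (chain_row (simplices C k) c <= kermx (bnd C k))%MS.
  apply/sub_kermxP; rewrite -chain_row_boundary // bd0.
  by apply/rowP => j; rewrite !mxE ffunE.
move=> /submx_trans/(_ van)/submxP[x eq_x].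
exists (row_chain x); first exact: row_chain_supported.
have := chain_row_boundary (ltn0Sn k) (row_chain_supported x).
rewrite row_chainK -eq_x /= => eq_bd; apply/ffunP => s.
have [sC|sC] := boolP (s \in simplices C k); last first.
  by rewrite supp_c // (boundary_supported _ cC (row_chain_supported x)).
have := congr1 (fun r : 'rV_#|simplices C k| => r 0 (enum_rank_in sC s)) eq_bd.
by rewrite !mxE enum_rankK_in.
Qed.

(** The sign of the permutation of s leading from one order to the other, computed by counting
    inversions. *)
Definition reorder_sign (ord ord' : T -> nat) s : rat :=
  \prod_(a in s) \prod_(b in s) (-1) ^+ ((ord a < ord b) && (ord' b < ord' a))%N.

Lemma reorder_sign2 ord ord' s : reorder_sign ord ord' s * reorder_sign ord ord' s = 1.
Proof.
rewrite /reorder_sign -big_split big1 // => a _; rewrite -big_split big1 // => b _ /=.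
by rewrite -expr2 sqrr_sign.
Qed.

(* Adding [v] to [t] creates the inversions between [v] and [t], which are the
   elements of [t] placed before [v] by exactly one of the two orders. *)
Lemma reorder_sign_before (ord ord' : T -> nat) v t :
  injective ord -> injective ord' -> v \notin t ->
  before ord v t * reorder_sign ord ord' (v |: t)
    = reorder_sign ord ord' t * before ord' v t.
Proof.
move=> inj inj' vt; rewrite /reorder_sign big_setU1 //= big_setU1 //= ltnn mul1r.
under [X in _ * (_ * X)]eq_bigr => a _ do rewrite big_setU1 //=.
rewrite big_split /= !mulrA mulrC; congr (_ * _).
rewrite /before -!big_split; apply: eq_bigr => a a_t /=.
have neq_av : a != v by apply: contraNneq vt => <-.
have := neq_av; rewrite -(inj_eq inj); have := neq_av; rewrite -(inj_eq inj').
case: (ltngtP (ord' a) (ord' v)) => // _ _; case: (ltngtP (ord a) (ord v)) => // _ _ /=.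
all: by rewrite ?expr1 ?expr0 ?mulr1 ?mul1r ?mulN1r ?opprK.
Qed.

(** Multiplying coefficients by [reorder_sign] is an involution that carries the boundary for [ord]
    to the boundary for [enum_rank], so fillings transfer from one orientation to the other. *)
Lemma hom_vanish_chain (ord : T -> nat) C k c : injective ord ->
  is_complex C -> hom_vanish C k -> (0 < k)%N ->
  supported c (simplices C k) -> boundary ord c = 0 ->
  exists2 d, supported d (simplices C k.+1) & boundary ord d = c.
Proof.
move=> inj cC van k_gt0 supp_c bd0.
pose sgn := reorder_sign (fun v => enum_rank v) ord.
pose tw c : chain := [ffun s => sgn s * c s].
have inj_rank : injective (fun v : T => enum_rank v : nat).
  by move=> u v /val_inj/enum_rank_inj.
have tw_bd c' : boundary (fun v => enum_rank v) (tw c') = tw (boundary ord c').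
  apply/ffunP => t; rewrite !ffunE [RHS]mulr_sumr; apply: eq_bigr => v vt.
  by rewrite !ffunE mulrA reorder_sign_before // mulrA.
have tw_supp c' A : supported c' A -> supported (tw c') A.
  by move=> supp s sA; rewrite ffunE supp // mulr0.
have twK c' : tw (tw c') = c'.
  by apply/ffunP => s; rewrite !ffunE mulrA reorder_sign2 mul1r.
have [|d supp_d bd_d] := hom_vanish_rank cC van k_gt0 (tw_supp _ _ supp_c).
  by rewrite tw_bd bd0; apply/ffunP => s; rewrite !ffunE mulr0.
exists (tw d); first exact: tw_supp.
by rewrite -[c]twK -bd_d -[d in RHS]twK tw_bd twK.
Qed.

Definition basis s : chain := [ffun t => (s == t)%:R].

Lemma boundary_basis ord s :
  boundary ord (basis s) = \sum_(v in s) before ord v (s :\ v) *: basis (s :\ v).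
Proof.
apply/ffunP => t; rewrite ffunE sum_ffunE big_mkcond [RHS]big_mkcond.
apply: eq_bigr => v _; rewrite !ffunE.
have [->|neq_s] := eqVneq s (v |: t).
  rewrite setU11; have [vt|vt] := boolP (v \in t).
    case: eqP => [eq_t|_]; last by rewrite [RHS]mulr0.
    by have := setD11 v (v |: t); rewrite eq_t vt.
  by rewrite mulr1 setU1K // eqxx [RHS]mulr1.
rewrite mulr0 if_same; case: ifP => // vs.
case: eqP => [eq_t|_]; last by rewrite [RHS]mulr0.
by rewrite -eq_t setD1K ?eqxx in neq_s.
Qed.

End Chains.

(** * Chain homotopy between two colorful simplices, and the cochain of a component *)

Section Transversals.
Variables (T : finType) (n : nat) (C : {set {set T}}) (V : 'I_n -> {set T}).
Local Notation chain := {ffun {set T} -> rat^o}.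
Hypothesis cC : is_complex C.
Hypothesis partV : is_vertex_partition C V.
Variable ord : T -> nat.
Hypothesis ord_inj : injective ord.
Hypothesis ord_color : forall i j u v,
  u \in V i -> v \in V j -> (i < j)%N -> (ord u < ord v)%N.

Lemma color_uniq v i j : v \in V i -> v \in V j -> i = j.
Proof.
have [_ disj _] := partV => vi vj; apply/eqP; apply: contraT => /disj.
by move=> /disjointFr/(_ vi); rewrite vj.
Qed.

Lemma ord_colorE i j u v : i != j -> u \in V i -> v \in V j -> (ord u < ord v)%N = (i < j)%N.
Proof.
move=> neq_ij ui vj; have := neq_ij; rewrite -val_eqE /=; case: (ltngtP i j) => // lt_ij _.
  exact: (ord_color ui vj lt_ij).
by apply/negbTE; rewrite -leqNgt ltnW // (ord_color vj ui lt_ij).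
Qed.

Lemma induced_complex X : is_complex (induced C X).
Proof.
move=> s t; rewrite !inE => /andP[sC sX] ts.
by rewrite (cC sC ts) (subset_trans ts sX).
Qed.

Definition color_transversal (x : 'I_n -> T) :=
  (forall i, x i \in V i) /\ x @: setT \in C.

Lemma color_transversal_inj x : color_transversal x -> injective x.
Proof. by move=> [xV _] i j eq_x; apply: (@color_uniq (x i)); rewrite // eq_x. Qed.

(** As [ord] increases with the color, [x] preserves orientations, and the incidence signs can be
    read off the colors alone. *)
Lemma transversal_boundary x (I : {set 'I_n}) : color_transversal x ->
  boundary ord (basis (x @: I)) =
    \sum_(i in I) before (@nat_of_ord n) i (I :\ i) *: basis (x @: (I :\ i)).
Proof.
move=> tx; have x_inj := color_transversal_inj tx; have [xV _] := tx.
rewrite boundary_basis big_imset /=; last by move=> i j _ _; apply: x_inj.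
apply: eq_bigr => i iI.
have -> : x @: I :\ x i = x @: (I :\ i).
  apply/setP => v; apply/setD1P/imsetP => [[neq_v /imsetP[j jI eq_v]]|[j]].
    by exists j; rewrite // in_setD1 jI andbT; apply: contraNneq neq_v => <-; apply/eqP.
  by rewrite in_setD1 => /andP[neq_j jI] ->; rewrite (inj_eq x_inj) imset_f.
congr (_ *: _); rewrite /before big_imset /=; last by move=> j k _ _; apply: x_inj.
apply: eq_bigr => j; rewrite in_setD1 => /andP[neq_ji _].
by rewrite (ord_colorE neq_ji).
Qed.

Lemma colorfulP s :
  reflect (exists2 x, color_transversal x & x @: setT = s) (colorful C V s).
Proof.
apply: (iffP andP) => [[sC /forallP card1]|[x tx <-]].
  have /fin_all_exists[x xP] i : exists v, s :&: V i = [set v].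
    exact/cards1P/card1.
  have x_s i : x i \in s /\ x i \in V i.
    by apply/andP; rewrite -in_setI xP set11.
  have eq_s : x @: setT = s.
    apply/setP => v; apply/imsetP/idP => [[i _ ->]|vs]; first by case: (x_s i).
    have [_ _ covV] := partV; have : v \in vertices C.
      by rewrite inE (cC sC) ?sub1set.
    rewrite -covV => /bigcupP[i _ vi]; exists i => //.
    by apply/set1P; rewrite -xP inE vs.
  by exists x => //; split=> [i|]; rewrite ?eq_s //; case: (x_s i).
have [xV xC] := tx; split=> //; apply/forallP => i; apply/cards1P; exists (x i).
apply/setP => v; apply/setIP/set1P => [[/imsetP[j _ ->] xji]|->].
  by rewrite (color_uniq (xV j) xji).
by rewrite imset_f.
Qed.

Definition induced_colors (I : {set 'I_n}) := induced C (\bigcup_(i in I) V i).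

Lemma basis_supported x (I : {set 'I_n}) : color_transversal x ->
  supported (basis (x @: I)) (simplices (induced_colors I) #|I|).
Proof.
move=> tx s; rewrite ffunE; case: eqP => // <-; rewrite inE card_imset ?eqxx.
  rewrite andbT negb_or inE => /andP[/negP[]]; have [xV xC] := tx.
  rewrite (cC xC) ?imsetS //=; apply/subsetP => _ /imsetP[i iI ->].
  by apply/bigcupP; exists i.
exact: color_transversal_inj.
Qed.

Lemma simplices_colorsS (I J : {set 'I_n}) k : I \subset J ->
  simplices (induced_colors I) k \subset simplices (induced_colors J) k.
Proof.
move=> sIJ; apply/subsetP => s; rewrite !inE => /andP[/orP[/andP[-> sI]|->] ->] //=.
  rewrite (subset_trans sI) //; apply/bigcupsP => i iI.
  by apply: bigcup_sup; apply: (subsetP sIJ).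
by rewrite orbT.
Qed.

(** The identity that the boundary squares to zero, with arbitrary chains as coefficients: removing
    i and j in the opposite order changes the sign, so the sum is its own opposite. *)
Lemma before_double_sum0 (I : {set 'I_n}) (h : {set 'I_n} -> chain) :
  \sum_(i in I) before (@nat_of_ord n) i (I :\ i) *:
    \sum_(j in I :\ i) before (@nat_of_ord n) j (I :\ i :\ j) *: h (I :\ i :\ j) = 0.
Proof.
set S := \sum_(i in I) _.
pose F i j : chain := before (@nat_of_ord n) i (I :\ i :\ j) *:
  (before (@nat_of_ord n) j (I :\ i :\ j) *: h (I :\ i :\ j)).
have SE : S = \sum_(i in I) \sum_(j in I | j != i) (-1) ^+ (j < i)%N *: F i j.
  apply: eq_bigr => i iI; rewrite scaler_sumr.
  apply: eq_big => [j|j jI]; first by rewrite in_setD1 andbC.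
  by rewrite {1}/before (big_setD1 j) //= -/(before _ _ _) -scalerA.
have : S = - S.
  rewrite {1}SE SE -sumrN (exchange_big_dep (mem I)) /=; last by move=> i j _ /andP[].
  apply: eq_bigr => i iI; rewrite -sumrN; apply: eq_big => [j|j /and3P[jI _ neq_ij]].
    by rewrite iI eq_sym.
  have -> : F j i = F i j.
    by rewrite /F !setDDl setUC !scalerA [X in X *: _]mulrC.
  rewrite -scaleNr; congr (_ *: _); move: neq_ij; rewrite -val_eqE /=.
  by case: (ltngtP i j) => //; rewrite ?expr0 ?expr1 ?opprK.
by move=> /ffunP eqS; apply/ffunP => s; move: (eqS s); rewrite !ffunE; lra.
Qed.

(** Induction on the size of I. The right-hand side is a cycle of C[V_I], because its boundary
    reduces by the induction hypothesis to the sum in [before_double_sum0]; the vanishing homology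
    provides a filling. *)
Lemma chain_homotopy x y : color_transversal x -> color_transversal y ->
  (forall I : {set 'I_n}, I != set0 -> hom_vanish (induced_colors I) #|I|) ->
  exists h : {set 'I_n} -> chain, forall I,
    supported (h I) (simplices (induced_colors I) #|I|.+1) /\
    boundary ord (h I) = basis (y @: I) - basis (x @: I)
      - \sum_(i in I) before (@nat_of_ord n) i (I :\ i) *: h (I :\ i).
Proof.
move=> tx ty van.
pose good (h : {set 'I_n} -> chain) I :=
    supported (h I) (simplices (induced_colors I) #|I|.+1) /\
    boundary ord (h I) = basis (y @: I) - basis (x @: I)
      - \sum_(i in I) before (@nat_of_ord n) i (I :\ i) *: h (I :\ i).
suff [h hP] : exists h, forall I : {set 'I_n}, (#|I| < n.+1)%N -> good h I.
  by exists h => I; apply: hP; rewrite ltnS -[X in (_ <= X)%N]card_ord max_card.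
elim: n.+1 => [|m [h hP]]; first by exists (fun=> 0).
have card_le k (I : {set 'I_n}) i : i \in I -> #|I| = k -> (#|I :\ i| < k)%N.
  by move=> iI <-; rewrite [X in (_ < X)%N](cardsD1 i) iI.
have /fin_all_exists[g gP] (I : {set 'I_n}) : exists d : chain, #|I| = m ->
    supported d (simplices (induced_colors I) #|I|.+1) /\
    boundary ord d = basis (y @: I) - basis (x @: I)
      - \sum_(i in I) before (@nat_of_ord n) i (I :\ i) *: h (I :\ i).
  have [card_I|neq_m] := eqVneq #|I| m; last by exists 0 => /eqP; rewrite (negbTE neq_m).
  (* For I empty, both transversals give the empty simplex, so the right-hand side is 0 and is
     filled by 0. *)
  have [->|I_neq0] := eqVneq I set0.
    exists 0 => _; split=> [s _|]; first by rewrite ffunE.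
    rewrite !imset0 subrr big_set0 subrr; apply/ffunP => t.
    by rewrite !ffunE big1 // => v _; rewrite ffunE mulr0.
  set c := _ - _.
  have supp_c : supported c (simplices (induced_colors I) #|I|).
    move=> s sI; have := basis_supported tx sI; have := basis_supported ty sI.
    rewrite /c !ffunE sum_ffunE => -> ->; rewrite subrr big1 ?subr0 //.
    move=> i iI; rewrite ffunE; have [supp_h _] := hP _ (card_le _ _ _ iI card_I).
    rewrite supp_h ?[LHS]mulr0 //; apply: contra sI.
    apply/subsetP; rewrite (cardsD1 i I) iI add1n.
    exact/simplices_colorsS/subD1set.
  have bd_c : boundary ord c = 0.
    rewrite /c !boundaryB boundary_sum !transversal_boundary //.
    rewrite -!sumrB -[RHS](before_double_sum0 I h); apply: eq_bigr => i iI.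
    have [_ ->] := hP _ (card_le _ _ _ iI card_I).
    by rewrite -!scalerBr opprB addrC subrK.
  have [d supp_d bd_d] : exists2 d, supported d (simplices (induced_colors I) #|I|.+1)
      & boundary ord d = c.
    apply: hom_vanish_chain; rewrite ?card_gt0 //; first exact: induced_complex.
    exact: van.
  by exists d => _.
exists (fun I : {set 'I_n} => if (#|I| < m)%N then h I else g I) => I.
rewrite ltnS leq_eqVlt /good => /orP[/eqP card_I|lt_Im].
  have [supp_g bd_g] := gP _ card_I; rewrite card_I ltnn -card_I.
  split=> //; rewrite bd_g; congr (_ - _); apply: eq_bigr => i iI.
  by rewrite card_I (card_le _ _ _ iI card_I).
rewrite lt_Im; have [supp_h bd_h] := hP _ lt_Im.
split=> //; rewrite bd_h; congr (_ - _); apply: eq_bigr => i iI.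
by rewrite (ltn_trans (card_le _ _ _ iI erefl) lt_Im).
Qed.

(** The pairing with the 0-1 cochain supported on [P], which becomes chi in the application. *)
Definition cocharge (P : pred {set T}) (c : chain) : rat := \sum_(s | P s) c s.

(** The sum is regrouped by simplices s. If s minus v is in [P] and v has color i, the only other
    colorful facet drops the vertex u of color i; it is adjacent to the first, hence in [P]. No
    vertex of another color lies between u and v in [ord], so the two signs are opposite. *)
Lemma cocharge_boundary0 (P : pred {set T}) (d : chain) :
  (forall s, P s -> colorful C V s) ->
  (forall s t, rg_adj C V s t -> P s = P t) ->
  supported d (simplices C n.+1) -> cocharge P (boundary ord d) = 0.
Proof.
move=> Pcol Padj supp_d; rewrite /cocharge.
pose F (s : {set T}) v : rat := if (v \in s) && P (s :\ v) then before ord v (s :\ v) * d s else 0.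
transitivity (\sum_(s : {set T}) \sum_(v : T) F s v).
  under eq_bigr => t _ do rewrite ffunE.
  rewrite (exchange_big_dep predT) //= [RHS]exchange_big; apply: eq_bigr => v _.
  rewrite -big_mkcond [RHS](reindex_onto (setU [set v]) (fun s => s :\ v)) /=; last first.
    by move=> s /andP[vs _]; rewrite setD1K.
  apply: eq_big => [t|t /andP[_ vt]]; last by rewrite setU1K.
  rewrite setU11 /=; have [vt|vt] := boolP (v \in t); last by rewrite setU1K // eqxx.
  rewrite andbF; apply/esym/negP => /andP[_ /eqP eq_t].
  by have := setD11 v (v |: t); rewrite eq_t vt.
rewrite big1 // => s _; have [/supp_d ds0|] := boolP (s \notin simplices C n.+1).
  by rewrite big1 // => v _; rewrite /F ds0 mulr0 if_same.
rewrite negbK inE orbF => /andP[sC /eqP card_s].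
have [/existsP[v /andP[vs Pv]]|no_v] := boolP [exists v, (v \in s) && P (s :\ v)]; last first.
  by rewrite big1 // => v _; rewrite /F (negbTE (existsPn no_v v)).
have /colorfulP[x tx eq_x] := Pcol _ Pv; have [xV xC] := tx.
have [i _ vi] : exists2 i, true & v \in V i.
  have [_ _ covV] := partV; have : v \in vertices C by rewrite inE (cC sC) ?sub1set.
  by rewrite -covV => /bigcupP[i _ vi]; exists i.
pose u := x i; have /setD1P[neq_uv us] : u \in s :\ v by rewrite -eq_x imset_f.
pose y j := if j == i then v else x j.
have eq_y : y @: setT = s :\ u.
  apply/setP => w; apply/imsetP/setD1P => [[j _ ->]|[neq_wu ws]].
    rewrite /y; have [_|neq_ji] := eqVneq j i; first by rewrite eq_sym.
    have /setD1P[_ xjs] : x j \in s :\ v by rewrite -eq_x imset_f.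
    by split=> //; rewrite /u (inj_eq (color_transversal_inj tx)).
  have [->|neq_wv] := eqVneq w v; first by exists i; rewrite // /y eqxx.
  have : w \in s :\ v by rewrite in_setD1 neq_wv.
  rewrite -eq_x => /imsetP[j _ eq_w]; exists j => //; rewrite /y; case: eqP => // eq_j.
  by rewrite eq_w eq_j eqxx in neq_wu.
have ty : color_transversal y.
  split=> [j|]; last by rewrite eq_y (cC sC) ?subD1set.
  by rewrite /y; case: eqP => // ->.
have Pu : P (s :\ u).
  rewrite -(Padj (s :\ v)) // /rg_adj (Pcol _ Pv); apply/and4P; split=> //.
  - by apply/colorfulP; exists y.
  - rewrite (_ : _ :|: _ = s) //; apply/setP => w; rewrite !inE -andb_orl.
    by case: (eqVneq w v) => //= ->; rewrite eq_sym neq_uv.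
  - rewrite (_ : _ :|: _ = s) ?card_s //; apply/setP => w; rewrite !inE -andb_orl.
    by case: (eqVneq w v) => //= ->; rewrite eq_sym neq_uv.
rewrite (bigD1 v) // (bigD1 u) //= big1 => [|w /andP[neq_wv neq_wu]]; last first.
  rewrite /F; case: ifP => // /andP[ws /Pcol/colorfulP[z tz eq_z]].
  have [zV _] := tz; have inz a : a \in s :\ w -> a \in V i -> a = z i.
    by rewrite -eq_z => /imsetP[j _ ->] zji; rewrite (color_uniq (zV j) zji).
  case/eqP: neq_uv; transitivity (z i).
    by apply: inz (xV i); rewrite in_setD1 eq_sym neq_wu.
  by apply/esym; apply: inz vi; rewrite in_setD1 eq_sym neq_wv.
rewrite addr0 /F vs us Pv Pu /= -mulrDl.
rewrite /before (big_setD1 u) ?in_setD1 ?neq_uv //= [X in _ + X](big_setD1 v) ?in_setD1 1?eq_sym ?neq_uv //=.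
set A := \prod_(w in s :\ v :\ u) _; set B := \prod_(w in s :\ u :\ v) _.
have -> : A = B.
  rewrite /A /B !setDDl [[set u] :|: _]setUC; apply: eq_bigr => w.
  rewrite !inE negb_or -andbA => /and3P[neq_wv neq_wu ws].
  have : w \in s :\ v by rewrite in_setD1 neq_wv.
  rewrite -eq_x => /imsetP[j _ eq_w].
  have neq_ji : j != i by apply: contraNneq neq_wu => eq_j; rewrite eq_w eq_j.
  by rewrite eq_w (ord_colorE neq_ji (xV j) vi) (ord_colorE neq_ji (xV j) (xV i)).
rewrite -mulrDl; have := neq_uv; rewrite -(inj_eq ord_inj).
by case: (ltngtP (ord u) (ord v)) => // _ _; rewrite expr0 expr1 ?subrr ?addNr !mul0r.
Qed.

Lemma hom_vanish_connected :
  (forall I : {set 'I_n}, I != set0 -> hom_vanish (induced_colors I) #|I|) ->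
  rg_connected C V.
Proof.
move=> van s t /[dup] cs /colorfulP[x tx eq_s] /[dup] ct /colorfulP[y ty eq_t].
apply: contraT => not_st.
have [h hP] := chain_homotopy tx ty van; have [supp_h bd_h] := hP setT.
pose P r := colorful C V r && connect (rg_adj C V) s r.
have adj_sym : symmetric (rg_adj C V).
  by move=> a b; rewrite /rg_adj andbCA setUC.
have conn_sym := sym_connect_sym adj_sym.
have : cocharge P (boundary ord (h setT)) = 0.
  apply: cocharge_boundary0 => [r /andP[]|r r' /[dup] adj /and4P[cr cr' _ _]|r rC].
  - by [].
  - by rewrite /P cr cr' /=; exact: (same_connect_r conn_sym (connect1 adj) s).
  - apply: supp_h; apply: contra rC; rewrite cardsT card_ord !inE.
    by case/andP=> /orP[/andP[-> _]|//] ->.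
rewrite bd_h eq_s eq_t /cocharge.
rewrite (eq_bigr (fun r => (t == r)%:R - (s == r)%:R)) => [|r /andP[cr _]]; last first.
  (* The chain h([n] \ i) lives on simplices without color i, so it has coefficient 0 on every
     colorful simplex. *)
  rewrite !ffunE sum_ffunE big1 ?subr0 // => i _.
  have [supp _] := hP (setT :\ i); rewrite ffunE supp ?[LHS]mulr0 //.
  rewrite inE orbF inE !negb_and; apply/orP; left; apply/orP; right.
  have /colorfulP[z tz <-] := cr; have [zV _] := tz.
  apply/subsetPn; exists (z i); first exact: imset_f.
  apply/bigcupP => -[j]; rewrite in_setD1 => /andP[neq_ji _] zj.
  by rewrite (color_uniq (zV i) zj) eqxx in neq_ji.
have sumP r0 : \sum_(r | P r) (r0 == r)%:R = (P r0)%:R :> rat.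
  rewrite big_mkcond (bigD1 r0) //= eqxx big1 ?addr0 => [|r /negbTE]; first by case: (P r0).
  by rewrite eq_sym => ->; rewrite if_same.
by rewrite sumrB !sumP /P (negbTE not_st) andbF cs connect0.
Qed.

End Transversals.

(** * Numerical colors and adjacency of facets *)

Section VertexColors.
Variables (T : finType) (n : nat) (C : {set {set T}}) (V : 'I_n -> {set T}).
Hypothesis cC : is_complex C.
Hypothesis partV : is_vertex_partition C V.

(** On a vertex of [C] the sum has a single term; elements of [T] outside all classes receive the
    default color 0. *)
Definition vertex_color v : nat := \sum_(i < n | v \in V i) i.

Lemma vertex_colorE i v : v \in V i -> vertex_color v = i.
Proof.
move=> vi; rewrite /vertex_color (big_pred1 i) // => j; apply/idP/eqP => [vj|-> //].
exact: color_uniq partV v j i vj vi.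
Qed.

Lemma vertex_colored s v : s \in C -> v \in s -> exists i, v \in V i.
Proof.
move=> sC vs; have [_ _ covV] := partV.
have : v \in vertices C by rewrite inE (cC sC) ?sub1set.
by rewrite -covV => /bigcupP[i _ vi]; exists i.
Qed.

Lemma colorful_of_card s : s \in C -> (#|s| <= n)%N ->
  (forall i, exists2 v, v \in s & v \in V i) -> colorful C V s.
Proof.
move=> sC le_s hit.
have /fin_all_exists2[x xs xV] i : exists2 v, v \in s & v \in V i by exact: hit.
have x_inj : injective x.
  by move=> i j eq_x; apply: (color_uniq partV (xV i)); rewrite eq_x.
have eq_s : x @: setT = s.
  apply/eqP; rewrite eqEcard card_imset // cardsT card_ord le_s andbT.
  by apply/subsetP => _ /imsetP[i _ ->].
by apply/(colorfulP cC partV); exists x; [split=> //; rewrite eq_s |].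
Qed.

(** The dropped points have the same color, so both facets are colorful and have n elements. Their
    union lies in s and has at most n+1 elements: with n+1 the facets are adjacent, and with n both
    equal the union. *)
Lemma colorful_facets_connected (P : 'I_n.+1 -> T) s k l :
  s \in C -> (forall i, P i \in s) -> k != l ->
  vertex_color (P k) = vertex_color (P l) ->
  (forall i, (i < n)%N -> exists a : 'I_n, vertex_color (P (lift k a)) = i) ->
  connect (rg_adj C V) [set P (lift k a) | a : 'I_n] [set P (lift l a) | a : 'I_n].
Proof.
move=> sC Ps neq_kl eq_c cov.
have hit_color i a : vertex_color (P a) = nat_of_ord i -> P a \in V i.
  have [j Pj] := vertex_colored sC (Ps a).
  by rewrite (vertex_colorE Pj) => /val_inj <-.
have card_le (b : 'I_n.+1) : (#|[set P (lift b a) | a : 'I_n]| <= n)%N.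
  by rewrite -[X in (_ <= X)%N](card_ord n) leq_imset_card.
have sub_s (b : 'I_n.+1) : [set P (lift b a) | a : 'I_n] \subset s.
  by apply/subsetP => _ /imsetP[a _ ->].
have col_k : colorful C V [set P (lift k a) | a : 'I_n].
  apply: colorful_of_card => // [|i]; first exact: cC sC (sub_s k).
  have [a /hit_color Pa] := cov i (ltn_ord i).
  by exists (P (lift k a)); first exact: imset_f.
have in_facet (b a : 'I_n.+1) : a != b -> P a \in [set P (lift b a) | a : 'I_n].
  by case: (unliftP b a) => [a' -> _|->]; [exact: imset_f | rewrite eqxx].
have col_l : colorful C V [set P (lift l a) | a : 'I_n].
  apply: colorful_of_card => // [|i]; first exact: cC sC (sub_s l).
  have [a colPa] := cov i (ltn_ord i).
  have [eq_a|neq_a] := eqVneq (lift k a) l; last first.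
    by exists (P (lift k a)); [exact: in_facet | exact: hit_color].
  exists (P k); first exact: in_facet.
  by apply: hit_color; rewrite eq_c -eq_a.
have card_colorful r : colorful C V r -> #|r| = n.
  case/(colorfulP cC partV) => x tx <-.
  by rewrite (card_imset _ (color_transversal_inj partV tx)) cardsT card_ord.
have [->|neq_kl'] := eqVneq [set P (lift k a) | a : 'I_n] [set P (lift l a) | a : 'I_n].
  exact: connect0.
apply: connect1; rewrite /rg_adj col_k col_l /=; apply/andP; split.
  by apply: cC sC _; rewrite subUset !sub_s.
rewrite eqn_leq; apply/andP; split.
  apply: (@leq_trans #|[set P a | a : 'I_n.+1]|).
    by apply/subset_leq_card/subsetP => v /setUP[] /imsetP[a _ ->]; apply: imset_f.
  by rewrite -[X in (_ <= X)%N](card_ord n.+1) leq_imset_card.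
rewrite ltnNge; apply: contra neq_kl' => le_U.
have eqU (b : 'I_n.+1) : colorful C V [set P (lift b a) | a : 'I_n] ->
    [set P (lift b a) | a : 'I_n] \subset
      [set P (lift k a) | a : 'I_n] :|: [set P (lift l a) | a : 'I_n] ->
    [set P (lift b a) | a : 'I_n] =
      [set P (lift k a) | a : 'I_n] :|: [set P (lift l a) | a : 'I_n].
  by move=> /card_colorful card_b sub; apply/eqP; rewrite eqEcard sub card_b.
by apply/eqP; rewrite (eqU k) ?subsetUl // [RHS](eqU l) ?subsetUr.
Qed.

End VertexColors.

Lemma hom_vanish_rg_connected (T : finType) (C : {set {set T}}) (n : nat)
    (V : 'I_n -> {set T}) :
  is_complex C -> is_vertex_partition C V ->
  (forall I : {set 'I_n}, I != set0 ->
     hom_vanish (induced C (\bigcup_(i in I) V i)) #|I|) ->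
  rg_connected C V.
Proof.
(* The lexicographic order by color and then [enum_rank]; division by [#|T|] recovers the color. *)
move=> cC partV; pose ord v := (vertex_color V v * #|T| + enum_rank v)%N.
have ord_div v : (ord v %/ #|T| = vertex_color V v)%N.
  by rewrite /ord divnMDl ?divn_small ?addn0 // (leq_ltn_trans _ (ltn_ord (enum_rank v))).
apply: (@hom_vanish_connected T n C V cC partV ord) => [u v eq_ord|i j u v ui vj lt_ij].
  have eq_c : vertex_color V u = vertex_color V v by rewrite -!ord_div eq_ord.
  by move: eq_ord; rewrite /ord eq_c => /addnI/val_inj/enum_rank_inj.
rewrite /ord (vertex_colorE partV ui) (vertex_colorE partV vj).
apply: (@leq_trans (i.+1 * #|T|)); first by rewrite mulSn addnC ltn_add2r.
by rewrite (leq_trans _ (leq_addr _ _)) // leq_mul2r lt_ij orbT.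
Qed.

(** * Homotopical connectivity *)

Section RowContinuity.
Variable R : realType.
Local Open Scope classical_set_scope.

Lemma row_ballP n (x y : 'rV[R]_n) (e : R) :
  ball x e y <-> 0 < e /\ forall i, `|x ord0 i - y ord0 i| < e.
Proof.
split=> [[e0 xy]|[e0 xy]]; split=> // i; first exact: xy.
by move=> j; rewrite ord1; apply: xy.
Qed.

Lemma within_rowP n m (A : set 'rV[R]_n) (f : 'rV[R]_n -> 'rV[R]_m) :
  {within A, continuous f} <->
  forall x, A x -> forall e : R, 0 < e -> exists2 d : R, 0 < d &
    forall y, A y -> (forall i, `|x ord0 i - y ord0 i| < d) ->
      forall j, `|f x ord0 j - f y ord0 j| < e.
Proof.
split=> [/subspace_continuousP cf x Ax e e0|cf].
  have /cvg_ballP/(_ e e0) := cf x Ax.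
  rewrite near_withinE => /nbhs_ballP[d /= d0 df]; exists d => // y Ay xy.
  by have /row_ballP[] : ball (f x) e (f y) by apply: df => //; apply/row_ballP.
apply/subspace_continuousP => x Ax; apply/cvg_ballP => e e0.
have [d d0 df] := cf x Ax e e0.
rewrite near_withinE; apply/nbhs_ballP; exists d => //= y /row_ballP[_ xy] Ay.
by apply/row_ballP; split=> //; apply: df.
Qed.

Lemma within_row_comp n m p (A : set 'rV[R]_n) (B : set 'rV[R]_m)
    (f : 'rV[R]_n -> 'rV[R]_m) (g : 'rV[R]_m -> 'rV[R]_p) :
  (forall x, A x -> B (f x)) ->
  {within A, continuous f} -> {within B, continuous g} ->
  {within A, continuous (g \o f)}.
Proof.
move=> fAB /within_rowP cf /within_rowP cg; apply/within_rowP => x Ax e e0.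
have [d d0 dg] := cg _ (fAB _ Ax) e e0; have [d' d'0 df] := cf _ Ax d d0.
by exists d' => // y Ay xy; apply: dg; [exact: fAB | exact: df].
Qed.

Lemma eq_within_row n m (A : set 'rV[R]_n) (f g : 'rV[R]_n -> 'rV[R]_m) :
  (forall x, A x -> f x = g x) ->
  {within A, continuous f} -> {within A, continuous g}.
Proof.
move=> fg /within_rowP cf; apply/within_rowP => x Ax e e0.
have [d d0 df] := cf _ Ax e e0; exists d => // y Ay xy j.
by rewrite -!fg //; apply: df.
Qed.

Lemma row_continuous (T : topologicalType) m (f : T -> 'rV[R]_m) :
  (forall j, continuous (fun x => f x ord0 j)) -> continuous f.
Proof.
move=> cf x; apply/cvg_ballP => e e0.
have : \forall y \near x, forall j, `|f x ord0 j - f y ord0 j| < e.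
  by apply: filter_forall => j; have /cvgrPdist_lt := cf j x; apply.
by apply: filterS => y xy; apply/row_ballP.
Qed.

(** The Heine-Cantor theorem: a radius r given by continuity at x for e/2 serves all points within
    r/2 of x once d < r/2, and compactness in its near-covering form makes one d work everywhere. *)
Lemma compact_row_uniform n m (A : set 'rV[R]_n) (f : 'rV[R]_n -> 'rV[R]_m) (e : R) :
  compact A -> {within A, continuous f} -> 0 < e ->
  exists2 d : R, 0 < d & forall x y, A x -> A y ->
    (forall i, `|x ord0 i - y ord0 i| < d) -> forall j, `|f x ord0 j - f y ord0 j| < e.
Proof.
move=> /compact_near_coveringP/near_covering_withinP cA /within_rowP cf e0.
pose P (d : R) (x : 'rV[R]_n) := forall y, A y ->
  (forall i, `|x ord0 i - y ord0 i| < d) -> forall j, `|f x ord0 j - f y ord0 j| < e.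
have near_P : \forall d \near (0 : R)^'+, A `<=` P d.
  apply: cA => x Ax.
  have e20 : 0 < e / 2 by rewrite divr_gt0.
  have [r r0 rf] := cf x Ax _ e20; have r20 : 0 < r / 2 by rewrite divr_gt0.
  exists ([set x' | ball x (r / 2) x'], [set d | d < r / 2]) => /=.
    by split; [exact: nbhsx_ballx | exact: nbhs_right_lt].
  move=> [x' d] /= [/row_ballP[_ xx'] dr] Ax' y Ay x'y j.
  have fxx' : `|f x ord0 j - f x' ord0 j| < e / 2.
    by apply: rf => // i; apply: lt_trans (xx' i) _; rewrite ltr_pdivrMr // mulr2n mulrDr mulr1 ltrDl.
  have fxy : `|f x ord0 j - f y ord0 j| < e / 2.
    apply: rf => // i; have := xx' i; have := lt_trans (x'y i) dr.
    have := ler_distD (x' ord0 i) (x ord0 i) (y ord0 i); lra.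
  have := ler_distD (f x ord0 j) (f x' ord0 j) (f y ord0 j).
  rewrite [`|f x' ord0 j - f x ord0 j|]distrC; lra.
have : \forall d \near (0 : R)^'+, 0 < d /\ A `<=` P d.
  by apply: filterI => //; exact: nbhs_right_gt.
move=> /filter_ex[d [d0 Pd]]; exists d => // x y Ax Ay; exact: Pd.
Qed.

Lemma coord_row_continuous n (i : 'I_n) : continuous (fun x : 'rV[R]_n => x ord0 i).
Proof. exact: coord_continuous. Qed.

Lemma sum_row_continuous (T : topologicalType) (J : finType) (P : pred J) (F : J -> T -> R) :
  (forall j, continuous (F j)) -> continuous (fun x => \sum_(j | P j) F j x).
Proof.
move=> cF; apply: (@continuous_big R J +%R) => [x|j _]; last exact: cF.
exact: add_continuous.
Qed.

Lemma prod_row_continuous (T : topologicalType) (J : finType) (P : pred J) (F : J -> T -> R) :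
  (forall j, continuous (F j)) -> continuous (fun x => \prod_(j | P j) F j x).
Proof.
move=> cF; apply: (@continuous_big R J *%R) => [x|j _]; last exact: cF.
exact: mul_continuous.
Qed.

Lemma max_row_continuous (T : topologicalType) (J : finType) (P : pred J) (F : J -> T -> R)
    (G : T -> R) : continuous G ->
  (forall j, continuous (F j)) -> continuous (fun x => \big[Num.max/G x]_(j | P j) F j x).
Proof.
move=> cG cF; rewrite /index_enum; elim: (Finite.enum _) => [|j r IHr].
  by under [X in continuous X]eq_fun => x do rewrite big_nil.
under [X in continuous X]eq_fun => x do rewrite big_cons.
case: (P j) => // x; apply: continuous_max; [exact: cF | exact: IHr].
Qed.

End RowContinuity.

(** * The cells of the prism as topological balls *)

Section Cells.
Variables (R : realType) (n : nat) (I : {set 'I_n}).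
Hypothesis I_neq0 : I != finset.set0.
Implicit Types (y : 'rV[R]_n) (w d : 'rV[R]_#|I|).

(** A model of the prism (face I) x [0, 1] as a truncated cone, with the coordinate sum minus 1 as
    height. *)
Definition cell y : Prop :=
  [/\ forall i, 0 <= y ord0 i, 1 <= \sum_i y ord0 i <= 2
    & forall i, i \notin I -> y ord0 i = 0].

Definition cell_boundary y : Prop :=
  cell y /\ [\/ \sum_i y ord0 i = 1, \sum_i y ord0 i = 2
    | exists2 i, i \in I & y ord0 i = 0].

(** Chosen so that the center, with its |I| coordinates 1/a, has coordinate sum 3/2, halfway between
    bottom and top. *)
Let a : R := 2 / 3 * #|I|%:R.

(* The Minkowski gauge of the convex body [cell], seen in R^I, with respect to
   its center (1/a, ..., 1/a). *)
Definition gauge w : R :=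
  \big[Num.max/2 * `|\sum_j w ord0 j|]_j (- w ord0 j * a).

Let a_gt0 : 0 < a.
Proof. by rewrite mulr_gt0 ?ltr0n ?card_gt0 ?divr_gt0. Qed.

Lemma gauge_le w m : gauge w <= m <->
  2 * `|\sum_j w ord0 j| <= m /\ forall j, - w ord0 j * a <= m.
Proof.
split=> [/bigmax_leP[le_s le_w]|[le_s le_w]]; first by split=> // j; apply: le_w.
by apply/bigmax_leP.
Qed.

Lemma gauge_ge w m : m <= gauge w <->
  m <= 2 * `|\sum_j w ord0 j| \/ exists j, m <= - w ord0 j * a.
Proof.
split=> [/bigmax_geP[|[j _]]|[|[j]] ge_m]; [by left | by right; exists j | |].
  by apply/bigmax_geP; left.
by apply/bigmax_geP; right; exists j.
Qed.

Lemma gaugeZ (t : R) w : 0 <= t -> gauge (t *: w) = t * gauge w.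
Proof.
move=> t0; rewrite /gauge.
apply: (big_ind2 (fun x y : R => y = t * x)) => [|x1 x2 y1 y2 -> ->|j _].
- under eq_bigr do rewrite mxE.
  by rewrite -mulr_sumr normrM (ger0_norm t0) mulrCA.
- by rewrite maxr_pMr.
- by rewrite mxE -mulrN -mulrA.
Qed.

Lemma gauge_gt0 w : w != 0 -> 0 < gauge w.
Proof.
move=> w_neq0; have [s0|s_neq0] := eqVneq (\sum_j w ord0 j) 0; last first.
  by apply: lt_le_trans (iffRL (gauge_ge _ _) (or_introl (lexx _))); rewrite mulr_gt0 ?normr_gt0.
have [j wj] : exists j, w ord0 j < 0.
  apply: contrapT => /forallNP w_ge0; case/eqP: w_neq0; apply/rowP => j; rewrite mxE.
  apply: (psumr_eq0P _ s0) => // i _; rewrite leNgt; apply/negP; exact: w_ge0.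
apply: (@lt_le_trans _ _ (- w ord0 j * a)); first by rewrite mulr_gt0 ?oppr_gt0.
by apply/gauge_ge; right; exists j.
Qed.

(** In terms of the displacement [w] from the center, the coordinate sum lies in [1, 2] when 2|sum
    w| <= 1, and a coordinate is nonnegative when -w_j a <= 1. Equality in one of them puts the
    point on the bottom, the top or a side. *)
Lemma gauge_cell y w :
  (forall j, y ord0 (enum_val j) = a^-1 + w ord0 j) ->
  (forall i, i \notin I -> y ord0 i = 0) ->
  (cell y <-> gauge w <= 1) /\ (cell_boundary y <-> gauge w = 1).
Proof.
move=> yE y0.
have sumE : \sum_i y ord0 i = 3 / 2 + \sum_j w ord0 j.
  rewrite (bigID (mem I)) /= [X in _ + X]big1 // addr0 big_enum_val /=.
  rewrite (eq_bigr (fun j => a^-1 + w ord0 j)) // big_split /= sumr_const card_ord.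
  congr (_ + _); rewrite /a -mulr_natr; field.
  by rewrite pnatr_eq0 cards_eq0.
have coordE i : i \in I -> exists2 j, y ord0 i = y ord0 (enum_val j) & y ord0 (enum_val j) = a^-1 + w ord0 j.
  by move=> iI; exists (enum_rank_in iI i); [rewrite enum_rankK_in | exact: yE].
have geE j : (0 <= a^-1 + w ord0 j) = (- w ord0 j * a <= 1).
  by rewrite -ler_pdivlMr // div1r -[RHS]subr_ge0 opprK.
have leE j : (a^-1 + w ord0 j <= 0) = (1 <= - w ord0 j * a).
  by rewrite -ler_pdivrMr // div1r -[LHS]subr_ge0 -[RHS]subr_ge0 sub0r opprD addrC.
have cellE : cell y <-> gauge w <= 1.
  rewrite gauge_le; split=> [[y_ge0 /andP[s1 s2] _]|[s_le w_le]].
    split=> [|j]; last by rewrite -geE -yE.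
    have : `|\sum_j w ord0 j| <= 1 / 2 by rewrite ler_norml; apply/andP; split; lra.
    lra.
  split=> // [i|]; last first.
    have : `|\sum_j w ord0 j| <= 1 / 2 by lra.
    by rewrite ler_norml => /andP[? ?]; apply/andP; split; lra.
  have [/coordE[j -> ->]|/y0->//] := boolP (i \in I).
  by rewrite geE.
split=> //; split=> [[/cellE le1 bd]|eq1].
  apply/eqP; rewrite eq_le le1; apply/gauge_ge; case: bd => [s|s|[i /coordE[j -> yj] y_i0]].
  - left; have -> : \sum_j w ord0 j = - (1 / 2) by lra.
    by rewrite normrN ger0_norm; lra.
  - left; have -> : \sum_j w ord0 j = 1 / 2 by lra.
    by rewrite ger0_norm; lra.
  - by right; exists j; rewrite -leE -yj y_i0.
have cy : cell y by apply/cellE; rewrite eq1.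
split=> //; have [y_ge0 /andP[s1 s2] _] := cy.
have /gauge_ge[s_ge|[j w_ge]] : 1 <= gauge w by rewrite eq1.
  have : 1 / 2 <= `|\sum_j w ord0 j| by lra.
  rewrite ler_normr => /orP[] s_ge'; [constructor 2|constructor 1]; lra.
constructor 3; exists (enum_val j); first exact: enum_valP.
by apply/eqP; rewrite eq_le y_ge0 andbT yE leE.
Qed.

Let norm2 w : R := Num.sqrt (\sum_j w ord0 j ^+ 2).

Lemma gauge_continuous : continuous gauge.
Proof.
have sum_cont : continuous (fun w => \sum_j w ord0 j).
  by apply: sum_row_continuous => j; apply: coord_row_continuous.
apply: max_row_continuous => [|j] w.
 exact: (cvgM (cvg_cst (2 : R)) (cvg_norm (@sum_cont w))).
exact: (cvgM (cvgN (@coord_row_continuous R _ j w)) (cvg_cst a)).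
Qed.

(** Radial projection from the center, trading the gauge for the Euclidean norm, compares the cell
    with the |I|-ball well enough to carry extension problems from one to the other. *)
Lemma cell_retraction :
  exists (alpha : 'rV[R]_#|I| -> 'rV[R]_n) (beta : 'rV[R]_n -> 'rV[R]_#|I|),
  [/\ continuous alpha, continuous beta,
      forall d, \sum_j d ord0 j ^+ 2 = 1 -> cell_boundary (alpha d),
      forall y, cell y -> \sum_j beta y ord0 j ^+ 2 <= 1 &
      forall y, cell_boundary y ->
        \sum_j beta y ord0 j ^+ 2 = 1 /\ alpha (beta y) = y].
Proof.
(* The second terms of the maxima in [M] and [D] keep these denominators positive at the origin.
   They are 0 on the unit sphere and on the boundary of the cell respectively, where the gauge and
   the norm remain. *)
pose M d := Num.max (gauge d) (1 - \sum_j d ord0 j ^+ 2).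
pose alpha d : 'rV[R]_n := \row_i \sum_(j | enum_val j == i) (a^-1 + d ord0 j / M d).
pose pi y : 'rV[R]_#|I| := \row_j (y ord0 (enum_val j) - a^-1).
pose D w := Num.max (norm2 w) (1 - gauge w).
pose beta y : 'rV[R]_#|I| := (D (pi y))^-1 *: pi y.
have gauge0 : gauge 0 = 0.
  by have := gaugeZ 0 (lexx 0); rewrite scale0r mul0r.
have sqs_ge0 w : 0 <= \sum_j w ord0 j ^+ 2 by apply: sumr_ge0 => j _; apply: sqr_ge0.
have norm2_gt0 w : w != 0 -> 0 < norm2 w.
  move=> w_neq0; rewrite sqrtr_gt0 lt_def sqs_ge0 andbT.
  apply: contra w_neq0 => /eqP s0; apply/eqP/rowP => j; rewrite mxE.
  apply/eqP; rewrite -sqrf_eq0; apply/eqP.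
  by apply: (psumr_eq0P _ s0) => // i _; apply: sqr_ge0.
have M_gt0 d : 0 < M d.
  rewrite lt_max; have [->|/gauge_gt0->//] := eqVneq d 0.
  by rewrite big1 ?subr0 ?ltr01 ?orbT // => j _; rewrite mxE expr0n.
have D_gt0 w : 0 < D w.
  rewrite lt_max; have [->|/norm2_gt0->//] := eqVneq w 0.
  by rewrite gauge0 subr0 ltr01 orbT.
have cell_pi y : cell y -> (cell y <-> gauge (pi y) <= 1) /\
    (cell_boundary y <-> gauge (pi y) = 1).
  by move=> [_ _ y0]; apply: gauge_cell => // j; rewrite mxE addrC subrK.
have betaE y : \sum_j beta y ord0 j ^+ 2 = (norm2 (pi y) / D (pi y)) ^+ 2.
  rewrite exprMn sqr_sqrtr // mulrC mulr_sumr; apply: eq_bigr => j _.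
  by rewrite mxE exprMn.
have sqs_cont : continuous (fun w => \sum_j w ord0 j ^+ 2).
  apply: sum_row_continuous => j w.
  exact: (cvgM (@coord_row_continuous R _ j w) (@coord_row_continuous R _ j w)).
have M_cont : continuous M.
  move=> d; apply: continuous_max; first exact: gauge_continuous.
  exact: (cvgB (cvg_cst (1 : R)) (@sqs_cont d)).
have D_cont : continuous D.
  move=> d; apply: continuous_max.
    by apply: (continuous_comp (g := Num.sqrt)); [exact: sqs_cont | exact: sqrt_continuous].
  exact: (cvgB (cvg_cst (1 : R)) (@gauge_continuous d)).
exists alpha, beta; split.
- apply: row_continuous => i; under [X in continuous X]eq_fun => d do rewrite mxE.
  apply: sum_row_continuous => j d.
  have M_neq0 : M d != 0 by rewrite gt_eqF.
  exact: (cvgD (cvg_cst a^-1) (cvgM (@coord_row_continuous R _ j d) (cvgV M_neq0 (@M_cont d)))).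
- have pi_cont : continuous pi.
    apply: row_continuous => j; under [X in continuous X]eq_fun => d do rewrite mxE.
    by move=> y; exact: (cvgB (@coord_row_continuous R _ (enum_val j) y) (cvg_cst a^-1)).
  apply: row_continuous => j; under [X in continuous X]eq_fun => d do rewrite mxE.
  have pij_cont : continuous (fun y => pi y ord0 j).
    by move=> y; apply: (continuous_comp (f := pi) (g := fun w => w ord0 j));
      [exact: pi_cont | exact: coord_row_continuous].
  have Dpi_cont : continuous (fun y => D (pi y)).
    by move=> y; apply: (continuous_comp (f := pi) (g := D)); [exact: pi_cont | exact: D_cont].
  move=> y; have D_neq0 : D (pi y) != 0 by rewrite gt_eqF.
  exact: (cvgM (cvgV D_neq0 (@Dpi_cont y)) (@pij_cont y)).
- move=> d d1; have Md : M d = gauge d.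
    apply/max_idPl; rewrite d1 subrr ltW // gauge_gt0 //.
    apply/eqP => d0; move/eqP: d1; rewrite d0 big1 => [|j _]; last by rewrite mxE expr0n.
    by rewrite eq_sym oner_eq0.
  have [||_ [_ bd]] := @gauge_cell (alpha d) ((M d)^-1 *: d).
  + move=> j; rewrite !mxE (big_pred1 j) => [|l]; first by rewrite mulrC.
    by rewrite (inj_eq enum_val_inj).
  + move=> i iI; rewrite mxE big_pred0 // => j; apply/eqP => eq_i.
    by rewrite -eq_i enum_valP in iI.
  apply: bd; rewrite gaugeZ ?invr_ge0 ?ltW // -Md mulVf // gt_eqF //.
- move=> y cy; rewrite betaE; apply: exprn_ile1.
    by rewrite divr_ge0 ?sqrtr_ge0 ?(ltW (D_gt0 _)).
  by rewrite ler_pdivrMr // mul1r le_max lexx.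
- move=> y by_; have [cy _] := by_; have [_ [/(_ by_) g1 _]] := cell_pi y cy.
  have pi_neq0 : pi y != 0.
    by apply/eqP => pi0; move/eqP: g1; rewrite pi0 gauge0 eq_sym oner_eq0.
  have DE : D (pi y) = norm2 (pi y).
    by apply/max_idPl; rewrite g1 subrr sqrtr_ge0.
  have n0 : norm2 (pi y) != 0 by rewrite gt_eqF ?norm2_gt0.
  have b1 : \sum_j beta y ord0 j ^+ 2 = 1 by rewrite betaE DE divff ?expr1n.
  split=> //; apply/rowP => i; rewrite mxE.
  have ME : M (beta y) = (norm2 (pi y))^-1.
    rewrite /M b1 subrr gaugeZ ?invr_ge0 ?(ltW (D_gt0 _)) // g1 mulr1 DE.
    by apply/max_idPl; rewrite invr_ge0 sqrtr_ge0.
  rewrite ME; have [iI|iI] := boolP (i \in I).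
    rewrite (big_pred1 (enum_rank_in iI i)) => [|l]; last first.
      apply/eqP/eqP => [eq_i|->]; last by rewrite enum_rankK_in.
      by apply: enum_val_inj; rewrite enum_rankK_in.
    by rewrite !mxE enum_rankK_in // DE invrK mulrAC mulVf // mul1r addrC subrK.
  have [_ _ /(_ _ iI)->] := cy; rewrite big_pred0 // => j; apply/eqP => eq_i.
  by rewrite -eq_i enum_valP in iI.
Qed.

End Cells.

Lemma interpolation_continuous (R : realType) (T : topologicalType) (f g h : T -> R) :
  continuous f -> continuous g -> continuous h ->
  continuous (fun x => (2 - f x) * g x + (f x - 1) / 2 * h x).
Proof.
move=> cf cg ch x.
exact: (cvgD (cvgM (cvgB (cvg_cst (2 : R)) (@cf x)) (@cg x))
  (cvgM (cvgM (cvgB (@cf x) (cvg_cst (1 : R))) (cvg_cst (2^-1 : R))) (@ch x))).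
Qed.

Section CellExtension.
Local Open Scope classical_set_scope.

(** The boundary map is pulled back to the sphere by [alpha], extended over the ball, and pulled
    back to the cell by [beta]. *)
Lemma cell_extension (T : finType) (C : {set {set T}}) n (I : {set 'I_n})
    (f : 'rV[Real]_n -> 'rV[Real]_#|T|) :
  I != finset.set0 -> homot_conn C #|I| ->
  {within cell_boundary I, continuous f} ->
  (forall y, cell_boundary I y -> realization C (f y)) ->
  exists g : 'rV[Real]_n -> 'rV[Real]_#|T|,
    [/\ {within cell I, continuous g},
        forall y, cell I y -> realization C (g y) &
        forall y, cell_boundary I y -> g y = f y].
Proof.
move=> I_neq0 conn cf fC.
have [alpha [beta [ca cb alphaP beta_cell betaP]]] := @cell_retraction Real n I I_neq0.
have [||g [cg gC gE]] := conn (f \o alpha).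
- apply: (within_row_comp (B := cell_boundary I)) => //.
  exact: continuous_subspaceT.
- by move=> _ [d d1 <-]; apply/fC/alphaP.
exists (g \o beta); split.
- apply: (within_row_comp (B := unit_ball #|I|)) => //.
  exact: continuous_subspaceT.
- by move=> y cy; apply: gC; exists (beta y) => //; apply: beta_cell.
- by move=> y bdy; have [b1 aby] := betaP y bdy; rewrite /= gE //= aby.
Qed.

Definition row_support n (y : 'rV[Real]_n) : {set 'I_n} := finset (fun i => y ord0 i != 0).

Lemma cellE n (I : {set 'I_n}) (y : 'rV[Real]_n) :
  cell I y <-> cell finset.setT y /\ row_support y \subset I.
Proof.
split=> [[y0 s12 yI]|[[y0 s12 _] yI]].
  split; first by split=> // i; rewrite inE.
  by apply/fintype.subsetP => i; rewrite inE; apply: contraR => /yI->.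
split=> // i; apply: contraNeq => yi; apply: (fintype.subsetP yI).
by rewrite inE.
Qed.

Lemma closed_cell n (I : {set 'I_n}) : topology_structure.closed (@cell Real n I).
Proof.
have sum_cont : continuous (fun y : 'rV[Real]_n => \sum_i y ord0 i).
  by apply: sum_row_continuous => i; apply: coord_row_continuous.
pose coord i := fun y : 'rV[Real]_n => y ord0 i.
pose total := fun y : 'rV[Real]_n => \sum_i y ord0 i.
have -> : @cell Real n I =
    classical_sets.bigcap (fun _ : 'I_n => True) (fun i => coord i @^-1` [set x | 0 <= x])
    `&` (total @^-1` [set x | 1 <= x] `&` total @^-1` [set x | x <= 2])
    `&` classical_sets.bigcap (fun i : 'I_n => i \notin I) (fun i => coord i @^-1` [set x | x = 0]).
  apply/seteqP; split=> [y [y0 /andP[s1 s2] yI]|y [[y0 [s1 s2]] yI]].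
    by split; [split; [move=> i _; exact: y0|] | move=> i iI; exact: yI].
  split=> [i||i iI]; [exact: (y0 i) | by apply/andP | exact: (yI i)].
apply: closedI; first apply: closedI.
- apply: closed_bigI => i _; apply: preimage_closed; [|exact: closed_ge].
  by move=> y _; apply: coord_row_continuous.
- apply: closedI; apply: preimage_closed; [|exact: closed_ge| |exact: closed_le].
    by move=> y _; apply: sum_cont.
  by move=> y _; apply: sum_cont.
- apply: closed_bigI => i _; apply: preimage_closed; [|exact: closed_eq].
  by move=> y _; apply: coord_row_continuous.
Qed.

(** * Filling the prism cell by cell *)

Section PrismFilling.
Variables (T : finType) (n : nat) (C : {set {set T}}) (V : 'I_n -> {set T}).
Hypothesis cC : is_complex C.
Hypothesis partV : is_vertex_partition C V.

Lemma realization_color_transversal x (J : {set 'I_n}) (w : 'I_n -> Real) z :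
  color_transversal C V x -> (forall i, 0 <= w i) -> \sum_i w i = 1 ->
  (forall i, w i != 0 -> i \in J) ->
  (forall v, coordv z v = \sum_(i | x i == v) w i) ->
  realization (induced_colors C V J) z /\
  forall v, coordv z v != 0 -> v \in [set x i | i in 'I_n]%SET.
Proof.
move=> tx w_ge0 w1 wJ zE.
have supp v : coordv z v != 0 -> exists2 i, i \in J & v = x i.
  rewrite zE => /eqP sum_neq0; apply: contrapT => no_i; apply: sum_neq0.
  apply: big1 => i /eqP eq_v; apply/eqP; apply: contraT => /wJ iJ.
  by case: no_i; exists i.
have [xV xC] := tx; split=> [|v /supp[i _ ->]]; last exact: imset_f.
split=> [v|]; first by rewrite zE sumr_ge0.
split.
  rewrite -w1 (eq_bigr (fun v => \sum_(i | x i == v) w i)) => [|v _]; last exact: zE.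
  by rewrite [RHS](partition_big x predT).
rewrite inE; apply/andP; split.
  apply: cC xC _; apply/fintype.subsetP => v; rewrite inE => /supp[i _ ->].
  by apply: imset_f; rewrite inE.
apply/fintype.subsetP => v; rewrite inE => /supp[i iJ ->].
by apply/finset.bigcupP; exists i.
Qed.

Variables (x x' : 'I_n -> T).
Hypotheses (tx : color_transversal C V x) (tx' : color_transversal C V x').

(** The invariant of the construction: the bottom, the top and the cells over faces in [L] are
    filled, a point over the face I goes into C[V_I], and the two ends go into the simplices of [x]
    and [x']. *)
Definition prism_filling (L : {set {set 'I_n}}) (F : 'rV[Real]_n -> 'rV[Real]_#|T|)
    (K : set 'rV[Real]_n) : Prop :=
  [/\ forall y, K y <-> cell finset.setT y /\
        [\/ row_support y \in L, \sum_i y ord0 i = 1 | \sum_i y ord0 i = 2],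
      {within K, continuous F},
      forall y, K y -> realization (induced_colors C V (row_support y)) (F y),
      forall y v, K y -> \sum_i y ord0 i = 1 -> coordv (F y) v != 0 ->
        v \in [set x i | i in 'I_n]%SET &
      forall y v, K y -> \sum_i y ord0 i = 2 -> coordv (F y) v != 0 ->
        v \in [set x' i | i in 'I_n]%SET].

Lemma prism_filling0 : exists F, exists2 K, topology_structure.closed K &
  prism_filling finset.set0 F K.
Proof.
pose total (y : 'rV[Real]_n) := \sum_i y ord0 i.
pose W z (y : 'rV[Real]_n) (v : T) := \sum_(i | z i == v) y ord0 i.
(* A formula continuous on the whole space. At sum 1 it is the affine map onto the simplex of [x]
   with weights y, at sum 2 the one onto the simplex of [x'] with weights y/2; [K] consists of these
   two ends. *)
pose F y : 'rV[Real]_#|T| := \row_l ((2 - total y) * W x y (enum_val l)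
  + (total y - 1) / 2 * W x' y (enum_val l)).
have FE y v : coordv (F y) v = (2 - total y) * W x y v + (total y - 1) / 2 * W x' y v.
  by rewrite /coordv mxE enum_rankK.
have total_cont : continuous total.
  by apply: sum_row_continuous => i; apply: coord_row_continuous.
have W_cont z v : continuous (fun y => W z y v).
  by apply: sum_row_continuous => i; apply: coord_row_continuous.
have F_cont : continuous F.
  apply: row_continuous => l; under [X in continuous X]eq_fun => y do rewrite mxE.
  exact: interpolation_continuous.
pose K := @cell Real n finset.setT `&` (total @^-1` [set a | a = 1] `|` total @^-1` [set a | a = 2]).
have F1 y : cell finset.setT y -> total y = 1 ->
    realization (induced_colors C V (row_support y)) (F y) /\
    forall v, coordv (F y) v != 0 -> v \in [set x i | i in 'I_n]%SET.
  move=> [y0 _ _] t1; apply: (@realization_color_transversal x _ (fun i => y ord0 i)) => //.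
    by move=> i yi; rewrite inE.
  by move=> v; rewrite FE t1 /W subrr !mul0r addr0; ring.
have F2 y : cell finset.setT y -> total y = 2 ->
    realization (induced_colors C V (row_support y)) (F y) /\
    forall v, coordv (F y) v != 0 -> v \in [set x' i | i in 'I_n]%SET.
  move=> [y0 _ _] t2; apply: (@realization_color_transversal x' _ (fun i => y ord0 i / 2)) => //.
  - by move=> i; rewrite divr_ge0.
  - by rewrite -mulr_suml -/(total y) t2 divff // pnatr_eq0.
  - by move=> i; rewrite mulf_eq0 negb_or inE => /andP[].
  - move=> v; rewrite FE t2 /W subrr mul0r add0r -mulr_suml; ring.
exists F, K.
  apply: closedI; first exact: closed_cell.
  by apply: closedU; apply: preimage_closed; rewrite ?closed_eq // => y _; apply: total_cont.
split.
- move=> y; split=> [[cy [t1|t2]]|[cy [|t1|t2]]].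
  + by split=> //; constructor 2.
  + by split=> //; constructor 3.
  + by rewrite inE.
  + by split=> //; left.
  + by split=> //; right.
- exact: continuous_subspaceT.
- by move=> y [cy [t1|t2]]; [case: (F1 y cy t1) | case: (F2 y cy t2)].
- by move=> y v [cy _] t1; have [_] := F1 y cy t1; apply.
- by move=> y v [cy _] t2; have [_] := F2 y cy t2; apply.
Qed.

Hypothesis conn : forall I : {set 'I_n}, I != finset.set0 ->
  homot_conn (induced_colors C V I) #|I|.

(** Induction on the size of [L]: removing a face I of maximal size keeps [L] closed under subsets.
    The region filled so far meets the cell over I exactly in its boundary, and [cell_extension]
    fills that cell within C[V_I]. *)
Lemma prism_filling_exists (L : {set {set 'I_n}}) :
  (forall I J : {set 'I_n}, I \in L -> J \subset I -> J \in L) ->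
  exists F, exists2 K, topology_structure.closed K & prism_filling L F K.
Proof.
move: {2}#|L| (leqnn #|L|) => k; elim: k L => [|k IHk] L le_k Ldown.
  by move: le_k; rewrite leqn0 cards_eq0 => /eqP->; apply: prism_filling0.
have [->|/finset.set0Pn[I0 I0L]] := eqVneq L finset.set0; first exact: prism_filling0.
case: (@arg_maxnP _ I0 (mem L) (fun I => #|I|) I0L) => I IL Imax.
rewrite /= in IL Imax.
have L'down (A B : {set 'I_n}) : A \in L :\ I -> B \subset A -> B \in L :\ I.
  rewrite !in_setD1 => /andP[neq_AI AL] sBA; rewrite (Ldown _ _ AL sBA) andbT.
  apply: contraNneq neq_AI => eq_B; rewrite eq_sym eqEcard -{1}eq_B sBA.
  exact: Imax.
have [|F [K K_closed [KP F_cont F_real F1 F2]]] := IHk (L :\ I) _ L'down.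
  by move: le_k; rewrite (cardsD1 I) IL.
have supp_neq0 (y : 'rV[Real]_n) : cell finset.setT y -> row_support y != finset.set0.
  move=> [_ /andP[s1 _] _]; apply/eqP => supp0; move: s1; rewrite big1 ?ler10 // => i _.
  by apply/eqP; apply: contraT => yi; rewrite -[false](finset.in_set0 i) -supp0 inE.
(* A point of the prism has coordinate sum at least 1, hence nonempty support, so the empty face
   adds nothing to the region. *)
have [I_eq0|I_neq0] := eqVneq I finset.set0.
  exists F, K => //; split=> // y; rewrite KP; split=> -[cy bd]; split=> //.
    by case: bd; [rewrite in_setD1 => /andP[_ yL]; constructor 1 | constructor 2 | constructor 3].
  case: bd => [yL|t1|t2]; [constructor 1 | by constructor 2 | by constructor 3].
  by rewrite in_setD1 yL I_eq0 supp_neq0.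
have bdP y : cell_boundary I y <-> cell I y /\ K y.
  rewrite KP; split=> [[cy bd]|[cy [cTy bd]]].
    have [cTy yI] := iffLR (cellE _ _) cy; split=> //; split=> //.
    case: bd => [t1|t2|[i iI yi]]; [by constructor 2 | by constructor 3 | constructor 1].
    rewrite in_setD1 (Ldown _ _ IL yI) andbT; apply/eqP => eq_y.
    by move: iI; rewrite -eq_y inE yi eqxx.
  split=> //; have [_ yI] := iffLR (cellE _ _) cy.
  case: bd => [|t1|t2]; [|by constructor 1 | by constructor 2].
  rewrite in_setD1 => /andP[neq_y _]; constructor 3.
  have /fintype.subsetPn[i iI yi] : ~~ (I \subset row_support y).
    by apply: contra neq_y => Iy; rewrite eqEsubset yI.
  by exists i => //; move: yi; rewrite inE negbK => /eqP.
have [||G [G_cont G_real GF]] := @cell_extension T (induced_colors C V I) n I F I_neq0 (conn I_neq0).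
- by apply: continuous_subspaceW F_cont => y /bdP[].
- move=> y /bdP[cy Ky]; have [_ yI] := iffLR (cellE _ _) cy.
  have [z0 [z1 zC]] := F_real y Ky; split=> //; split=> //.
  move: zC; rewrite !inE => /andP[-> /fintype.subset_trans->] //.
  by apply/finset.bigcupsP => i iy; apply: finset.bigcup_sup; apply: (fintype.subsetP yI).
(* [F] and [G] agree on the common part of their domains; as both domains are closed, the glued map
   is continuous on the union. *)
pose F' y := if row_support y \subset I then G y else F y.
have F'K y : K y -> F' y = F y.
  rewrite /F' => Ky; case: ifP => // yI; apply: GF; apply/bdP; split=> //.
  by apply/cellE; split=> //; have [] := iffLR (KP y) Ky.
have F'G y : cell I y -> F' y = G y.
  by move=> cy; have [_ yI] := iffLR (cellE _ _) cy; rewrite /F' yI.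
have K'P y : (K `|` @cell Real n I) y <-> cell finset.setT y /\
        [\/ row_support y \in L, \sum_i y ord0 i = 1 | \sum_i y ord0 i = 2].
  split=> [[/KP[cy bd]|/cellE[cy yI]]|[cy bd]].
  - split=> //; case: bd; [|by constructor 2 | by constructor 3].
    by rewrite in_setD1 => /andP[_ yL]; constructor 1.
  - by split=> //; constructor 1; apply: Ldown IL yI.
  - have [eq_y|neq_y] := eqVneq (row_support y) I.
      by right; apply/cellE; rewrite eq_y; split.
    left; apply/KP; split=> //; case: bd => [yL|t1|t2]; [|by constructor 2 | by constructor 3].
    by constructor 1; rewrite in_setD1 neq_y.
have inK y : (K `|` @cell Real n I) y -> K y \/ (row_support y = I /\ cell I y).
  move=> [Ky|cy]; first by left.
  have [eq_y|neq_y] := eqVneq (row_support y) I; first by right.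
  left; apply/KP; have [cTy yI] := iffLR (cellE _ _) cy; split=> //; constructor 1.
  by rewrite in_setD1 neq_y (Ldown _ _ IL yI).
have endK y : (K `|` @cell Real n I) y ->
    \sum_i y ord0 i = 1 \/ \sum_i y ord0 i = 2 -> K y.
  by move=> /K'P[cy _] t12; apply/KP; split=> //; case: t12; [constructor 2 | constructor 3].
exists F', (K `|` @cell Real n I).
  by apply: closedU => //; apply: closed_cell.
split=> // [|y /inK[Ky|[eq_y cy]]|y v Ky t1|y v Ky t2].
- apply: withinU_continuous => //; first exact: closed_cell.
    by apply: eq_within_row F_cont => y Ky; rewrite F'K.
  by apply: eq_within_row G_cont => y Ky; rewrite F'G.
- by rewrite F'K //; apply: F_real.
- by rewrite F'G // eq_y; apply: G_real.
- have Ky' : K y by apply: endK => //; left.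
  by rewrite F'K //; apply: F1.
- have Ky' : K y by apply: endK => //; right.
  by rewrite F'K //; apply: F2.
Qed.

End PrismFilling.

End CellExtension.

(** * The collapse of the cube onto the prism *)

Section CubeToPrism.
Variable R : realType.
Local Open Scope classical_set_scope.

(* [stick a m] are the barycentric coordinates of the image of a point of the
   m-cube under the collapse of the cube onto the m-simplex: at the face
   a_i = 1 the i-th coordinate vanishes, at a_i = 0 all later ones do. *)
Definition stick m (a : 'I_m.+1 -> R) (i : 'I_m.+1) : R :=
  (\prod_(j : 'I_m.+1 | (j < i)%N) a j) * (if (i < m)%N then 1 - a i else 1).

(** Telescoping: with b k the product of the first k coordinates, [stick a i] is b i - b (i+1) for i
    < m, and b m for i = m. *)
Lemma sum_stick m (a : 'I_m.+1 -> R) : \sum_i stick a i = 1.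
Proof.
pose b (k : nat) := \prod_(j : 'I_m.+1 | (j < k)%N) a j.
have bS (i : 'I_m.+1) : b i.+1 = b i * a i.
  rewrite /b (bigD1 i) //= mulrC; congr (_ * _); apply: eq_bigl => j.
  by rewrite ltnS ltn_neqAle andbC.
rewrite big_ord_recr /= {2}/stick ltnn mulr1 -/(b m).
rewrite (eq_bigr (fun i : 'I_m => b i - b i.+1)) => [|i _]; last first.
  by rewrite /stick /= ltn_ord (bS (widen_ord (leqnSn m) i)) mulrBr mulr1.
have -> : \sum_(i < m) (b i - b i.+1) = b 0%N - b m.
  elim: (m) => [|k IHk]; first by rewrite big_ord0 subrr.
  by rewrite big_ord_recr /= IHk addrA subrK.
by rewrite subrK /b big_pred0.
Qed.

Definition cube m : set 'rV[R]_m := [set u | forall i, `[0, 1] (u ord0 i)].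

(** The first m coordinates are collapsed onto the m-simplex by [stick]; the last one is the height,
    scaling the coordinate sum from 1 to 2. *)
Definition cube_prism m (u : 'rV[R]_m.+1) : 'rV[R]_m.+1 :=
  \row_i ((1 + u ord0 ord_max) * stick (u ord0) i).

Lemma sum_cube_prism m (u : 'rV[R]_m.+1) :
  \sum_i cube_prism u ord0 i = 1 + u ord0 ord_max.
Proof. by under eq_bigr do rewrite mxE; rewrite -mulr_sumr sum_stick mulr1. Qed.

Lemma cube_prism_cell m (u : 'rV[R]_m.+1) : cube u -> cell finset.setT (cube_prism u).
Proof.
move=> cu; have u_ge0 i : 0 <= u ord0 i by have /andP[] := cu i.
have u_le1 i : u ord0 i <= 1 by have /andP[] := cu i.
split=> [i||i]; last by rewrite inE.
  rewrite mxE mulr_ge0 ?addr_ge0 ?ler01 // /stick mulr_ge0 ?prodr_ge0 //.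
  by case: ifP => // _; rewrite subr_ge0.
by rewrite sum_cube_prism; have := u_ge0 ord_max; have := u_le1 ord_max; lra.
Qed.

Lemma cube_prism_continuous m : continuous (@cube_prism m).
Proof.
apply: row_continuous => i; under [X in continuous X]eq_fun => u do rewrite mxE.
have coord j := @coord_row_continuous R m.+1 j.
have prod_cont : continuous (fun u : 'rV[R]_m.+1 => \prod_(j : 'I_m.+1 | (j < i)%N) u ord0 j).
  by apply: prod_row_continuous => j; apply: coord.
move=> u; rewrite /stick; case: (i < m)%N.
  exact: (cvgM (cvgD (cvg_cst (1 : R)) (@coord ord_max u))
    (cvgM (@prod_cont u) (cvgB (cvg_cst (1 : R)) (@coord i u)))).
exact: (cvgM (cvgD (cvg_cst (1 : R)) (@coord ord_max u))
  (cvgM (@prod_cont u) (cvg_cst (1 : R)))).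
Qed.

Lemma compact_cube m : compact (@cube m).
Proof.
by apply: (@rV_compact _ _ (fun _ : 'I_m => `[(0 : R), 1]%classic)) => _; apply: segment_compact.
Qed.

(** The truncation by [minn] puts the image of every x in the cube, also for x outside the grid. *)
Definition grid_point m N (x : nat -> nat) : 'rV[R]_m :=
  \row_i ((minn (x i) N.+1)%:R / N.+1%:R).

Lemma grid_point_cube m N x : cube (grid_point m N x).
Proof.
move=> i; rewrite /= in_itv /= mxE divr_ge0 //= ler_pdivrMr ?ltr0n // mul1r.
by rewrite ler_nat geq_minr.
Qed.

Lemma grid_point_close m N (x y : nat -> nat) (i : 'I_m) : (x i <= y i <= (x i).+1)%N ->
  `|grid_point m N x ord0 i - grid_point m N y ord0 i| <= N.+1%:R^-1.
Proof.
move=> /andP[le_xy le_yx]; rewrite !mxE -mulrBl normrM [X in _ * X]ger0_norm ?invr_ge0 //.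
rewrite ler_piMl ?invr_ge0 // distrC -natrB; last by lia.
by rewrite normr_nat lern1; lia.
Qed.

End CubeToPrism.

(** * From a filled prism to a path of colorful simplices *)

Section HomotopicConnectivity.
Local Open Scope classical_set_scope.

Lemma realization_big_coord (T : finType) (C : {set {set T}}) z :
  realization C z -> exists v, #|T|%:R^-1 <= coordv z v.
Proof.
move=> [_ [z1 _]]; apply: contrapT => /forallNP small.
have T_neq0 : (0 < #|T|)%N.
  rewrite lt0n; apply/negP => /eqP T0; move: z1.
  by rewrite big1 => [/esym/eqP|v _]; [rewrite oner_eq0 | have := fintype0 v T0].
have : \sum_(v : T) coordv z v < \sum_(v : T) (#|T|%:R^-1 : Real).
  apply: ltr_sum => [|v _]; last by rewrite ltNge; apply/negP; apply: small.
  by have /card_gt0P[v _] := T_neq0; apply/hasP; exists v; rewrite ?mem_index_enum.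
by rewrite z1 sumr_const -[_ *+ _]mulr_natl divff ?ltxx // pnatr_eq0 -lt0n.
Qed.

Lemma homot_conn_rg_connected (T : finType) (C : {set {set T}}) (n : nat)
    (V : 'I_n -> {set T}) :
  is_complex C -> is_vertex_partition C V ->
  (forall I : {set 'I_n}, I != finset.set0 -> homot_conn (induced_colors C V I) #|I|) ->
  rg_connected C V.
Proof.
(* With no colors the empty set is the only colorful simplex; [cube_prism] needs n = m + 1. *)
case: n V => [|m] V cC partV conn s t.
  move=> /(colorfulP cC partV)[x _ <-] /(colorfulP cC partV)[y _ <-].
  rewrite (_ : [set x i | i in [set: 'I_0]%SET]%SET = [set y i | i in [set: 'I_0]%SET]%SET) //.
  by apply: eq_imset => -[].
move=> /(colorfulP cC partV)[x tx <-] /(colorfulP cC partV)[x' tx' <-].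
have [F [K _ [KP F_cont F_real F1 F2]]] :=
  @prism_filling_exists T _ C V cC x x' tx tx' conn finset.setT (fun I J _ _ => finset.in_setT J).
have K_cube u : cube u -> K (cube_prism u).
  by move=> cu; apply/KP; split; [exact: cube_prism_cell | constructor 1; rewrite inE].
pose f u := F (cube_prism u).
have f_cont : {within @cube Real m.+1, continuous f}.
  apply: (within_row_comp (B := K)) => //.
  exact: continuous_subspaceT (@cube_prism_continuous _ m).
(* Each point of ||C|| has a coordinate at least [e], and its vertex will be the label. If two
   values of [f] differ by less than [e] in each coordinate, the label of one is also in the support
   of the other. *)
pose e : Real := #|T|%:R^-1.
have e_gt0 : 0 < e by rewrite invr_gt0 ltr0n; apply/card_gt0P; exists (x ord0).
have [d d_gt0 f_unif] := compact_row_uniform (@compact_cube _ m.+1) f_cont e_gt0.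
pose N := Num.bound d^-1.
have N_lt : N.+1%:R^-1 < d.
  rewrite invf_plt ?posrE ?ltr0n //; apply: lt_trans (archi_boundP _) _.
    by rewrite invr_ge0 ltW.
  by rewrite ltr_nat.
pose pt := @grid_point Real m.+1 N.
have cube_pt y : cube (pt y) by apply: grid_point_cube.
have real_pt y : realization (induced_colors C V (row_support (cube_prism (pt y)))) (f (pt y)).
  exact/F_real/K_cube.
have /choice[L LP] y : exists v, e <= coordv (f (pt y)) v.
  exact: realization_big_coord (real_pt y).
have L_neq0 y : coordv (f (pt y)) (L y) != 0.
  by rewrite gt_eqF // (lt_le_trans e_gt0).
(* Since [f] respects the faces of the prism, the color of a label is the index of a nonzero
   coordinate of the prism point; this yields Sperner's condition. *)
have L_color y : exists2 i, cube_prism (pt y) ord0 i != 0 & L y \in V i.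
  have [_ [_ ]] := real_pt y; rewrite inE => /andP[_ /fintype.subsetP/(_ (L y))].
  by rewrite inE => /(_ (L_neq0 y))/finset.bigcupP[i iy Li]; exists i; rewrite // inE in iy.
have pt0 (y : nat -> nat) (j : 'I_m.+1) : y j = 0%N -> pt y ord0 j = 0.
  by move=> yj; rewrite mxE yj min0n mul0r.
have pt1 (y : nat -> nat) (j : 'I_m.+1) : y j = N.+1 -> pt y ord0 j = 1.
  by move=> yj; rewrite mxE yj minnn divff // pnatr_eq0.
have sum_pt y : \sum_i cube_prism (pt y) ord0 i = 1 + pt y ord0 ord_max.
  exact: sum_cube_prism.
have adj_sym : symmetric (rg_adj C V).
  by move=> a b; rewrite /rg_adj andbCA finset.setUC.
have col_inj z : color_transversal C V z ->
    {in [set z i | i in 'I_m.+1]%SET &, injective (vertex_color V)} /\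
    #|[set z i | i in 'I_m.+1]%SET| = m.+1.
  move=> tz; have [zV _] := tz; split.
    move=> _ _ /imsetP[i _ ->] /imsetP[j _ ->].
    by rewrite !(vertex_colorE partV (zV _)) => /val_inj ->.
  by rewrite (card_imset _ (color_transversal_inj partV tz)) card_ord.
have [x_inj x_card] := col_inj x tx; have [x'_inj x'_card] := col_inj x' tx'.
have setTE z : z @: finset.setT = [set z i | i in 'I_m.+1]%SET.
  by apply/finset.setP => v; apply/imsetP/imsetP => -[i _ ->]; exists i; rewrite ?inE.
rewrite !setTE.
apply: (@rainbow_path T N m L (vertex_color V) (rg_adj C V)) => //.
- by move=> y; have [i _ Li] := L_color y; rewrite (vertex_colorE partV Li) -ltnS.
- move=> y j lt_jm yj; have [i yi Li] := L_color y.
  rewrite (vertex_colorE partV Li) leqNgt; apply: contra yi => lt_ji.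
  have lt_jm1 : (j < m.+1)%N by apply: ltn_trans lt_jm _.
  rewrite mxE /stick (bigD1 (Ordinal lt_jm1)) //= (pt0 y (Ordinal lt_jm1)) //.
  by rewrite !mul0r mulr0.
- move=> y j lt_jm yj; have [i yi Li] := L_color y.
  rewrite (vertex_colorE partV Li); apply: contra yi => /eqP eq_i.
  by rewrite mxE /stick eq_i lt_jm (pt1 y i) ?eq_i // subrr !mulr0.
- move=> y ym; apply: (F1 (cube_prism (pt y))); rewrite ?L_neq0 //.
    exact/K_cube/cube_pt.
  by rewrite sum_pt pt0 // addr0.
- move=> y ym; apply: (F2 (cube_prism (pt y))); rewrite ?L_neq0 //.
    exact/K_cube/cube_pt.
  by rewrite sum_pt pt1.
(* All vertices of a cell are within [d] of its first vertex, so all its labels lie in the support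
   of the value of [f] there, which is a simplex of [C]. *)
- move=> v p k l P neq_kl eq_c /rainbowP cov.
  have [_ [_ ]] := real_pt (kuhn_cell v p ord0).
  rewrite inE => /andP[sigmaC _].
  apply: (colorful_facets_connected cC partV sigmaC _ neq_kl eq_c cov) => b.
  rewrite inE gt_eqF //.
  have close j : `|pt (kuhn_cell v p ord0) ord0 j - pt (kuhn_cell v p b) ord0 j| < d.
    by apply: le_lt_trans N_lt; apply: grid_point_close; apply: kuhn_cell_close.
  have := f_unif _ _ (cube_pt _) (cube_pt _) close (enum_rank (P b)).
  have := LP (kuhn_cell v p b); rewrite /coordv ltr_norml => le_e /andP[lt_e _].
  by move: le_e lt_e; rewrite -/(P b); lra.
- exact: sym_connect_sym.
Qed.

End HomotopicConnectivity.

Local Close Scope ring_scope.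

Theorem theorem2p2 (T : finType) (C : {set {set T}}) (n : nat)
    (V : 'I_n -> {set T}) (e : eta_kind) :
  is_complex C ->
  is_vertex_partition C V ->
  (forall I : {set 'I_n}, I != set0 ->
     eta_ge e (induced C (\bigcup_(i in I) V i)) #|I|.+1) ->
  rg_connected C V.
Proof.
move=> cC partV eta; case: e eta => eta.
  (* The index k = |I|, allowed by the bound |I|+1, stands for connectivity in dimension |I| - 1. *)
  by apply: homot_conn_rg_connected => // I I_neq0; apply: (eta I I_neq0).
by apply: hom_vanish_rg_connected => // I I_neq0; apply: (eta I I_neq0).
Qed.
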